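(* Let $(w(k))_{k\ge 1}$ be a sequence of real numbers with $w(k)\to\infty$ as $k\to\infty$. Then there exists a sequence of integers $(r(k))_{k\ge1}$ with $r(k)=o(w(k))$ as $k\to\infty$ such that the symmetric set $$\Lambda=\{k^2+r(k): k\ge 1\}\cup\{-(k^2+r(k)): k\ge 1\}$$ is a Menshov spectrum.
   Context: $\mathbb{T}=\mathbb{R}/2\pi\mathbb{Z}$, and $L^0(\mathbb{T})$ is the space of all measurable functions $f:\mathbb{T}\to\mathbb{C}$. A set $\Lambda\subset\mathbb{Z}$ is called a Menshov spectrum if for every $f\in L^0(\mathbb{T})$ there are complex coefficients $(c_k)_{k\in\Lambda}$ such that $f(t)=\lim_{N\to\infty}\sum_{k\in\Lambda,\,|k|\le N}c_k e^{ikt}$ for almost every $t\in\mathbb{T}$. *)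

(* Defs.v *)
From HB Require Import structures.
From mathcomp Require Import all_boot all_order all_algebra.
From mathcomp Require Import complex.
From mathcomp Require Import all_classical all_reals all_analysis.
From mathcomp Require Import measurable_realfun.

Set Implicit Arguments.
Unset Strict Implicit.
Unset Printing Implicit Defensive.

Import Order.TTheory GRing.Theory Num.Theory.
Import numFieldNormedType.Exports.
Local Open Scope classical_set_scope.
Local Open Scope ring_scope.
Local Open Scope complex_scope.

(* Functions on the circle R/2piZ are represented by
   2pi-periodic functions on R; a set of points of the circle is measurable
   (resp. null) iff its preimage in R is. *)

(* R endowed with the sigma-algebra of Lebesgue-measurable sets, i.e. the
   completion of the Borel one. *)
Definition lebesgueType (R : realType) :=
  g_sigma_algebraType (completed_algebra_gen (@lebesgue_measure R)).

(* A complex function is measurable when its real and imaginary parts are. *)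
Definition L0_circle (R : realType) (f : R -> R[i]) : Prop :=
  [/\ periodic f (pi *+ 2),
      measurable_fun (setT : set (lebesgueType R))
        (fun t : lebesgueType R => complex.Re (f t))
    & measurable_fun (setT : set (lebesgueType R))
        (fun t : lebesgueType R => complex.Im (f t))].

Definition expi (R : realType) (x : R) : R[i] := cos x +i* sin x.

(* The index set of the sum is finite, so this is an ordinary sum. *)
Definition partial_sum (R : realType) (L : set int) (c : int -> R[i])
    (t : R) (N : nat) : R[i] :=
  \sum_(k \in L `&` [set k | `|k| <= N%:Z]) c k * expi (k%:~R * t).

(* Only the values of c on L matter.  [R[i]^o] carries the topology of the
   complex modulus. *)
Definition Menshov_spectrum (R : realType) (L : set int) : Prop :=
  forall f : R -> R[i], L0_circle f ->
  exists c : int -> R[i],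
    {ae @lebesgue_measure R,
      forall t, partial_sum L c t @ \oo --> (f t : R[i]^o)}.

(* Main.v *)
(* Since w tends to infinity, a window of consecutive k placed far enough out may
   carry shifts r(k) as large as any constant fixed beforehand, and can thus encode
   the frequencies of every trigonometric polynomial p of a given size.  On such a
   window one realizes p * W up to a small error in measure, where
   W = kappa * sum_(j < M) cos (N_j t) is a small multiple of a lacunary sum: each
   cos (N_j t) * p is cut into frequencies N_j + n (n a frequency of p), and each of
   these is spread over shifted squares by a Riesz product g close to 1 in measure.
   Starting from f and applying this repeatedly to the residual, i windows with
   W_1, ..., W_i of widely separated frequencies leave the residual f * prod_(j <= i) (1 + W_j).  As
   |1 + W_j| <= G_j ^ 2 with G_j of mean less than a constant gamma < 1, Markov's
   inequality makes this residual tend to 0 in measure, and the partial sums are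
   bounded by |f| * (1 + Y ^ 2), where Y >= 0 has mean at most a universal constant
   because the maximal lacunary sums have bounded fourth moments.  A function
   approximable in measure by polynomials p_l is then represented by adding, in
   successive windows, the difference between p_l and the sum obtained so far;
   Borel-Cantelli gives convergence almost everywhere. *)

Require Import Defs.
From HB Require Import structures.
From mathcomp Require Import all_boot all_order all_algebra.
From mathcomp Require Import complex.
From mathcomp Require Import all_classical all_reals all_analysis.
From mathcomp Require Import measurable_realfun.
From mathcomp Require Import zify ring lra.

Import Order.TTheory GRing.Theory Num.Theory.
Import numFieldNormedType.Exports.
Local Open Scope classical_set_scope.
Local Open Scope ring_scope.

Set Implicit Arguments.
Unset Strict Implicit.
Unset Printing Implicit Defensive.

(** A polynomial times cos (N t) may need many consecutive frequencies, while near K ^ 2 the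
    spectrum offers one frequency per gap of length about 2 K. The shift at k = K + i therefore
    cancels i ^ 2 and adds a label: the frequencies become K ^ 2 + 2 K i + label, and the shifts do
    not depend on K. A wave of frequency N + n fits only at an index of label n. It is multiplied by
    a function of 2 K t that is almost 1 but has no constant term, namely 1 minus a Riesz product;
    this moves it to nonzero offsets, and different n use dilations by different powers of a prime,
    told apart by divisibility.

    As W has mean 0, |1 + W| has mean at least 1; hence the detour through its square root,
    dominated by a polynomial G of mean below 1. The majorants G, Q, Y are polynomials so that means
    multiply as soon as frequencies are widely separated. The coefficient kappa is 1 / (8 sqrt M): a
    partial sum may stop inside a block, which is harmless because one block has size proportional
    to kappa, whereas W keeps a fixed variance. *)

(** * Calculus of real trigonometric polynomials given as lists of waves *)

Section TrigPolynomials.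
Context {R : realType}.
Implicit Types (p q : seq (R * R * int)) (t : R).

(* A triple (a, phi, n) stands for the wave a * cos (n t + phi); the frequency n
   may be negative, and repetitions are allowed. *)
Definition ev p t : R := \sum_(x <- p) x.1.1 * cos (x.2%:~R * t + x.1.2).
(** The mean over a period, see [integral_ev]. Means are computed algebraically, as constant
    terms. *)
Definition ct p : R := \sum_(x <- p | x.2 == 0) x.1.1 * cos x.1.2.
Definition nrm p : R := \sum_(x <- p) `|x.1.1|.
Definition deg p : nat := \max_(x <- p) `|x.2|%N.

Definition tone : seq (R * R * int) := [:: (1, 0, 0)].
Definition tcos (n : int) : seq (R * R * int) := [:: (1, 0, n)].
Definition tscale (c : R) p := [seq (c * x.1.1, x.1.2, x.2) | x <- p].
Definition tdil (m : int) p := [seq (x.1, m * x.2) | x <- p].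
Definition tmul p q :=
  [seq (x.1.1 * y.1.1 / 2, x.1.2 + y.1.2, x.2 + y.2) | x <- p, y <- q] ++
  [seq (x.1.1 * y.1.1 / 2, x.1.2 - y.1.2, x.2 - y.2) | x <- p, y <- q].

Lemma ev_cat p q t : ev (p ++ q) t = ev p t + ev q t.
Proof. by rewrite /ev big_cat. Qed.

Lemma ct_cat p q : ct (p ++ q) = ct p + ct q.
Proof. by rewrite /ct big_cat. Qed.

Lemma nrm_cat p q : nrm (p ++ q) = nrm p + nrm q.
Proof. by rewrite /nrm big_cat. Qed.

Lemma ev_flatten I (s : seq I) (f : I -> seq (R * R * int)) t :
  ev (flatten [seq f i | i <- s]) t = \sum_(i <- s) ev (f i) t.
Proof. by rewrite /ev big_flatten big_map. Qed.

Lemma nrm_flatten I (s : seq I) (f : I -> seq (R * R * int)) :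
  nrm (flatten [seq f i | i <- s]) = \sum_(i <- s) nrm (f i).
Proof. by rewrite /nrm big_flatten big_map. Qed.

Lemma ev_one t : ev tone t = 1.
Proof. by rewrite /ev big_seq1 /= mul0r add0r cos0 mulr1. Qed.

Lemma ct_one : ct tone = 1.
Proof. by rewrite /ct big_cons big_nil /= cos0 mulr1 addr0. Qed.

Lemma ev_cos n t : ev (tcos n) t = cos (n%:~R * t).
Proof. by rewrite /ev big_seq1 /= mul1r addr0. Qed.

Lemma ct_cos n : ct (tcos n) = (n == 0)%:R.
Proof. by rewrite /ct big_cons big_nil /= cos0; case: eqP; rewrite ?mulr1 ?addr0. Qed.

Lemma ev_scale c p t : ev (tscale c p) t = c * ev p t.
Proof. by rewrite /ev big_map mulr_sumr; apply: eq_bigr => x _; rewrite mulrA. Qed.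

Lemma ct_scale c p : ct (tscale c p) = c * ct p.
Proof. by rewrite /ct big_map mulr_sumr; apply: eq_bigr => x _; rewrite mulrA. Qed.

Lemma nrm_scale c p : nrm (tscale c p) = `|c| * nrm p.
Proof. by rewrite /nrm big_map mulr_sumr; apply: eq_bigr => x _; rewrite normrM. Qed.

Lemma ev_dil m p t : ev (tdil m p) t = ev p (m%:~R * t).
Proof.
by rewrite /ev big_map; apply: eq_bigr => x _ /=; rewrite mulrA intrM (mulrC m%:~R).
Qed.

Lemma ct_dil m p : m != 0 -> ct (tdil m p) = ct p.
Proof.
by move=> m0; rewrite /ct big_map; apply: eq_bigl => x /=; rewrite mulf_eq0 (negbTE m0).
Qed.

Lemma nrm_dil m p : nrm (tdil m p) = nrm p.
Proof. by rewrite /nrm big_map. Qed.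

Lemma ev_mul p q t : ev (tmul p q) t = ev p t * ev q t.
Proof.
rewrite ev_cat /ev !big_allpairs_dep -big_split mulr_suml; apply: eq_bigr => x _ /=.
rewrite -big_split mulr_sumr; apply: eq_bigr => y _ /=.
rewrite (_ : (x.2 + y.2)%:~R * t + _ = (x.2%:~R * t + x.1.2) + (y.2%:~R * t + y.1.2));
  last by rewrite rmorphD /=; ring.
rewrite (_ : (x.2 - y.2)%:~R * t + _ = (x.2%:~R * t + x.1.2) - (y.2%:~R * t + y.1.2));
  last by rewrite rmorphB /=; ring.
by rewrite cosD cosB; field.
Qed.

Lemma nrm_ge0 p : 0 <= nrm p.
Proof. by apply: sumr_ge0. Qed.

Lemma nrm_mul p q : nrm (tmul p q) = nrm p * nrm q.
Proof.
rewrite nrm_cat /nrm !big_allpairs_dep -big_split mulr_suml; apply: eq_bigr => x _ /=.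
rewrite -big_split mulr_sumr; apply: eq_bigr => y _ /=.
by rewrite !normrM normfV (ger0_norm (ler0n _ 2)); field.
Qed.

Lemma ev_le_nrm p t : `|ev p t| <= nrm p.
Proof.
rewrite (le_trans (ler_norm_sum _ _ _))//; apply: ler_sum => x _.
by rewrite normrM ler_piMr// ler_norml cos_geN1 cos_le1.
Qed.

Lemma mem_deg p x : x \in p -> (`|x.2| <= deg p)%N.
Proof. by move=> xp; exact: (leq_bigmax_seq (P:=xpredT) (F:=fun x : R * R * int => `|x.2|%N) x xp isT). Qed.

Lemma deg_le p d : (forall x, x \in p -> (`|x.2| <= d)%N) -> (deg p <= d)%N.
Proof. by move=> h; apply/bigmax_leqP_seq => x xp _; exact: h. Qed.

Lemma deg_mul p q : (deg (tmul p q) <= deg p + deg q)%N.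
Proof.
apply: deg_le => z; rewrite mem_cat => /orP[] /allpairsP[[x y] /= [xp yq ->]] /=;
  have := mem_deg xp; have := mem_deg yq; move: (abszN y.2); move: (deg p) (deg q) => m n; case: x y {xp yq} => [? a] [? b] /=; lia.
Qed.

Lemma deg_cat p q : deg (p ++ q) = maxn (deg p) (deg q).
Proof. by rewrite /deg big_cat. Qed.

Lemma deg_scale c p : deg (tscale c p) = deg p.
Proof. by rewrite /deg big_map. Qed.

Lemma ct_mul p q :
  {in p & q, forall x y, (`|x.2| = `|y.2|)%N -> y.2 = 0} ->
  ct (tmul p q) = ct p * ct q.
Proof.
move=> h.
have ctE r : ct r = \sum_(x <- r) (if x.2 == 0 then x.1.1 * cos x.1.2 else 0).
  by rewrite /ct big_mkcond.
rewrite ct_cat !ctE !big_allpairs_dep -big_split mulr_suml big_seq [RHS]big_seq.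
apply: eq_bigr => x xp /=.
rewrite -big_split mulr_sumr big_seq [RHS]big_seq.
apply: eq_bigr => y yq /=; have {}h := h x y xp yq.
have [x0|x0] := eqVneq x.2 0; have [y0|y0] := eqVneq y.2 0.
- by rewrite x0 y0 !(addr0, subr0) eqxx cosD cosB; field.
- by rewrite x0 !(add0r, sub0r, oppr_eq0) (negbTE y0) !(mulr0, addr0).
- by rewrite y0 !(addr0, subr0) (negbTE x0) !(mul0r, addr0).
- have xy : `|x.2|%N <> `|y.2|%N by move=> /h y0'; rewrite y0' eqxx in y0.
  rewrite mul0r; have -> : (x.2 + y.2 == 0) = false by apply/negP => /eqP ?; lia.
  have -> : (x.2 - y.2 == 0) = false by apply/negP => /eqP; lia.
  by rewrite addr0.
Qed.

(** This plays the part of independence: a product of two waves contains only the sum and the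
    difference of their frequencies, so a constant arises only from two constants. *)
Lemma ct_mul_gap p q :
  (forall y, y \in q -> y.2 = 0 \/ (deg p < `|y.2|)%N) ->
  ct (tmul p q) = ct p * ct q.
Proof.
move=> h; apply: ct_mul => x y /mem_deg xp /h[//|yq xy].
by move: yq; rewrite -xy ltnNge xp.
Qed.

Lemma continuous_ev p : continuous (ev p).
Proof.
elim: p => [|x p ih] t.
  have -> : ev [::] = cst 0 by apply/funext => u; rewrite /ev big_nil.
  exact: cst_continuous.
have -> : ev (x :: p) = (fun t => x.1.1 * cos (x.2%:~R * t + x.1.2)) \+ ev p.
  by apply/funext => u; rewrite /ev big_cons.
apply: cvgD; last exact: ih.
apply: cvgM; first exact: cvg_cst.
apply: (@cvg_comp _ _ _ (fun t => x.2%:~R * t + x.1.2) cos _ (nbhs (x.2%:~R * t + x.1.2))); last exact: continuous_cos.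
apply: cvgD; last exact: cvg_cst.
by apply: cvgM; [exact: cvg_cst|exact: cvg_id].
Qed.

Lemma measurable_ev p : measurable_fun setT (ev p).
Proof. by apply: continuous_measurable_fun; exact: continuous_ev. Qed.

Lemma sin_int2pi (n : int) (x : R) : sin (n%:~R * (pi *+ 2) + x) = sin x.
Proof.
rewrite addrC; case: n => n.
  by rewrite -pmulrn mulr_natl (periodicn (@sinD2pi R)).
rewrite NegzE mulrNz mulNr -pmulrn mulr_natl.
by rewrite -(periodicn (@sinD2pi R) n.+1 (x - _)) subrK.
Qed.

Let prim p t : R := ct p * t +
  \sum_(x <- p | x.2 != 0) x.1.1 / x.2%:~R * sin (x.2%:~R * t + x.1.2).

Let is_derive_prim p t : is_derive t 1 (prim p) (ev p t).
Proof.
elim: p => [|x p ih].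
  have -> : prim [::] = cst 0.
    by apply/funext => u; rewrite /prim /ct !big_nil mul0r addr0.
  by rewrite /ev big_nil; exact: is_derive_cst.
have [x0|x0] := eqVneq x.2 0.
  have -> : prim (x :: p) = (x.1.1 * cos x.1.2) \*: id + prim p.
    apply/funext => u; rewrite /prim /ct !big_cons x0 eqxx /= fctE /=.
    by rewrite /GRing.scale/=; ring.
  rewrite /ev big_cons x0 mul0r add0r.
  apply: is_derive_eq.
  by rewrite /GRing.scale/= mulr1.
have x0' : x.2%:~R != 0 :> R by rewrite intr_eq0.
have -> : prim (x :: p) = (x.1.1 / x.2%:~R) \*: (sin \o (x.2%:~R \*: id + cst x.1.2)) + prim p.
  apply/funext => u; rewrite /prim /ct !big_cons (negbTE x0) /= fctE /= !fctE.
  by rewrite /GRing.scale/=; ring.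
rewrite /ev big_cons.
apply: is_derive_eq.
rewrite !fctE /GRing.scale/= mulr1 addr0; congr (_ + _).
by field.
Qed.

Lemma integral_ev p :
  (\int[lebesgue_measure]_(t in `[0%R, (pi *+ 2)%R]) (ev p t)%:E =
   (pi *+ 2 * ct p)%:E)%E.
Proof.
have tp : 0 < pi *+ 2 :> R by rewrite pmulrn_lgt0// pi_gt0.
rewrite (@continuous_FTC2 _ (ev p) (prim p) _ _ tp).
- rewrite -EFinB; congr EFin; rewrite /prim mulr0 add0r.
  rewrite (eq_bigr (fun x => x.1.1 / x.2%:~R * sin (x.2%:~R * 0 + x.1.2)));
    first by rewrite addrK mulrC.
  by move=> x _; rewrite mulr0 sin_int2pi add0r.
- exact/continuous_subspaceT/continuous_ev.
- split=> [t _||]; first exact: ex_derive.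
    by apply: cvg_at_right_filter; apply: differentiable_continuous; apply/derivable1_diffP; exact: ex_derive.
  by apply: cvg_at_left_filter; apply: differentiable_continuous; apply/derivable1_diffP; exact: ex_derive.
- by move=> t _; rewrite derive1E; apply: derive_val.
Qed.

End TrigPolynomials.

Arguments tone : simpl never.
Arguments tcos : simpl never.
Arguments tscale : simpl never.
Arguments tdil : simpl never.
Arguments tmul : simpl never.

(** * Markov's inequality for nonnegative polynomials *)

Section Markov.
Context {R : realType}.
Notation mu := (@lebesgue_measure R).
Implicit Types (p q : seq (R * R * int)) (t : R).

Definition circ : set R := [set` `[0, pi *+ 2]%R].

Lemma measurable_circ : measurable circ.
Proof. exact: measurable_itv. Qed.

Lemma mu_circ : mu circ = (pi *+ 2)%:E.
Proof.
by rewrite /circ lebesgue_measure_itv/= lte_fin pmulrn_lgt0// pi_gt0 -EFinB subr0.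
Qed.

Lemma measurable_ev_ge p (l : R) : measurable [set t | l <= ev p t].
Proof.
rewrite (_ : [set _ | _] = ev p @^-1` [set` `[l, +oo[%R]).
  by rewrite -[X in measurable X]setTI; apply: measurable_ev => //; exact: measurable_itv.
by apply/seteqP; split=> t /=; rewrite in_itv/= andbT.
Qed.

Lemma markov_ev p (l : R) : (forall t, 0 <= ev p t) -> 0 < l ->
  (mu (circ `&` [set t | (l <= ev p t)%R]) <= (pi *+ 2 * ct p / l)%:E)%E.
Proof.
move=> p0 l0; set A := _ `&` _.
have mA : measurable A.
  by apply: measurableI; [exact: measurable_circ|exact: measurable_ev_ge].
rewrite EFinM lee_pdivlMr// -integral_ev muleC -integral_cst//.
apply: (@le_trans _ _ (\int[mu]_(t in A) (ev p t)%:E)%E).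
  apply: ge0_le_integral => //=.
  - by move=> t _; rewrite lee_fin ltW.
  - apply/measurable_EFinP; apply: measurable_funS (measurable_ev p) => //.
  - by move=> t [_ /=]; rewrite lee_fin.
apply: ge0_subset_integral => //=.
- by apply/measurable_EFinP; apply: measurable_funS (measurable_ev p).
- by move=> t _; rewrite lee_fin.
- by move=> t [].
Qed.

End Markov.

(** * Polynomials without constant term that are close to 1 in measure *)

Section Gamma.
Context {R : realType}.
Notation mu := (@lebesgue_measure R).

Lemma pow_small (x e : R) : 0 <= x < 1 -> 0 < e -> exists m, x ^+ m <= e.
Proof.
move=> /andP[x0 x1] e0.
have /cvgrPdist_le/(_ e e0)[m _ /(_ m (leqnn m))] : x ^+ n @[n --> \oo] --> (0 : R).
  by apply: cvg_expr; rewrite ger0_norm.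
by rewrite /= sub0r normrN ger0_norm ?exprn_ge0// => ?; exists m.
Qed.

Definition rfac (n : nat) : seq (R * R * int) := tone ++ tcos n%:Z.
(** With v = cos (n t) this is 1 + v / 2 - v ^ 2 / 12, which dominates the square root of 1 + v on
    [-1, 1] and has mean 23 / 24 for n > 0. *)
Definition rmaj (n : nat) : seq (R * R * int) :=
  tone ++ tscale 2^-1 (tcos n%:Z) ++ tscale (- 12^-1) (tmul (tcos n%:Z) (tcos n%:Z)).
Arguments rfac : simpl never.
Arguments rmaj : simpl never.

Fixpoint riesz (m : nat) : seq (R * R * int) :=
  if m is m'.+1 then tmul (riesz m') (rfac (4 ^ m')) else tone.

Fixpoint riesz_maj (m : nat) : seq (R * R * int) :=
  if m is m'.+1 then
    tmul (riesz_maj m') (rmaj (4 ^ m'))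
  else tone.

Lemma deg_one : deg (@tone R) = 0%N.
Proof. by rewrite /deg big_seq1. Qed.

Lemma deg_cos (n : int) : deg (@tcos R n) = `|n|%N.
Proof. by rewrite /deg big_seq1. Qed.

Lemma deg_riesz m : (deg (riesz m) < 4 ^ m)%N.
Proof.
elim: m => [|m ih] /=; first by rewrite deg_one.
rewrite (leq_ltn_trans (deg_mul _ _))// /rfac deg_cat deg_one deg_cos max0n absz_nat expnS; lia.
Qed.

Lemma ct_riesz m : ct (riesz m) = 1.
Proof.
elim: m => [|m ih] /=; first exact: ct_one.
rewrite ct_mul_gap ?ih /rfac ?ct_cat ?ct_one ?ct_cos ?mul1r.
  have -> : ((4 ^ m)%N%:Z == 0) = false by apply/negbTE; rewrite -lt0n expn_gt0.
  by rewrite addr0.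
move=> y; rewrite /rfac /tone /tcos mem_cat !inE => /orP[] /eqP -> /=; first by left.
by right; rewrite deg_riesz.
Qed.

Lemma ev_riesz_ge0 m t : 0 <= ev (riesz m) t.
Proof.
elim: m => [|m ih] /=; first by rewrite ev_one.
by rewrite ev_mul mulr_ge0// /rfac ev_cat ev_one ev_cos -lerBlDl sub0r cos_geN1.
Qed.

(** The square in [rmaj] doubles the frequency 4 ^ m; the ratio 4 still keeps the degree of the
    product below the next frequency. *)
Lemma deg_riesz_maj m : (deg (riesz_maj m) < 4 ^ m)%N.
Proof.
elim: m => [|m ih] /=; first by rewrite deg_one.
rewrite (leq_ltn_trans (deg_mul _ _))// /rmaj !deg_cat !deg_scale deg_one max0n.
have := deg_mul (@tcos R (4 ^ m)%N) (@tcos R (4 ^ m)%N).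
by rewrite deg_cos absz_nat expnS; lia.
Qed.

Lemma ct_riesz_maj m : ct (riesz_maj m) = (23 / 24) ^+ m.
Proof.
elim: m => [|m ih] /=; first exact: ct_one.
have n0 : ((4 ^ m)%N%:Z == 0) = false.
  by apply/negbTE; rewrite -lt0n expn_gt0.
rewrite ct_mul_gap.
  rewrite ih exprSr; congr (_ * _).
  rewrite /rmaj !ct_cat !ct_scale ct_one ct_cos n0.
  rewrite /ct /tmul /tcos /= !big_cons big_nil /= !(subrr, eqxx) !(addr0, subr0) cos0.
  have -> : ((4 ^ m)%N%:Z + (4 ^ m)%N%:Z == 0) = false.
    by apply/negbTE; rewrite -lt0n addn_gt0 expn_gt0.
  by field.
move=> y; have := deg_riesz_maj m.
rewrite /rmaj /tone /tscale /tmul /tcos !mem_cat !inE => dm /or4P[|||] /eqP -> /=.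
- by left.
- by right.
- by right; lia.
- by left; rewrite subrr.
Qed.

Lemma sqrt_majorant1 (v : R) : -1 <= v <= 1 ->
  0 <= 1 + v / 2 - v ^+ 2 / 12 /\ 1 + v <= (1 + v / 2 - v ^+ 2 / 12) ^+ 2.
Proof.
move=> /andP[v1 v2]; split; first by nra.
rewrite -subr_ge0.
have -> : (1 + v / 2 - v ^+ 2 / 12) ^+ 2 - (1 + v) =
  v ^+ 2 * ((1 - v) / 12 + v ^+ 2 / 144) by field.
apply: mulr_ge0; first exact: sqr_ge0.
by apply: addr_ge0; [lra|rewrite mulr_ge0// ?sqr_ge0// invr_ge0].
Qed.

Lemma ev_riesz_maj m t :
  0 <= ev (riesz_maj m) t /\ ev (riesz m) t <= ev (riesz_maj m) t ^+ 2.
Proof.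
elim: m => [|m [ih1 ih2]] /=; first by rewrite ev_one expr1n.
rewrite !ev_mul /rmaj /rfac !ev_cat !ev_scale !ev_mul ev_one ev_cos.
set v := cos _.
have [|h1 h2] := @sqrt_majorant1 v; first by rewrite cos_geN1 cos_le1.
have -> : 1 + (2^-1 * v + - 12^-1 * (v * v)) = 1 + v / 2 - v ^+ 2 / 12 by field.
split; first exact: mulr_ge0.
rewrite exprMn ler_pM ?ev_riesz_ge0//.
by rewrite -lerBlDl sub0r cos_geN1.
Qed.

(** The polynomial is 1 minus a Riesz product, whose mean 1 cancels the constant term. The Riesz
    product is at most the square of [riesz_maj], of mean (23 / 24) ^ m, hence small in measure.
    Dilation does not change means, so one [g] serves every N. *)
Lemma gamma_exists (d : R) : 0 < d -> exists g : seq (R * R * int),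
  (forall x, x \in g -> x.2 != 0) /\
  forall N : int, N != 0 -> exists E : set R,
    [/\ measurable E, (mu E <= d%:E)%E &
      forall t, circ t -> ~ E t -> `|ev g (N%:~R * t) - 1| <= d].
Proof.
(* Off the exceptional set the Riesz product is at most h ^ 2, and h ^ 2 <= h <= d thanks to the cap
   at 1. *)
move=> d0; pose h := Num.min d 1.
have h0 : 0 < h by rewrite lt_min d0 ltr01.
have tp : 0 < pi *+ 2 :> R by rewrite pmulrn_lgt0// pi_gt0.
have [||m hm] := @pow_small (23 / 24) (h * d / (pi *+ 2)); first by lra.
  by rewrite divr_gt0// mulr_gt0.
exists [seq (- x.1.1, x.1.2, x.2) | x <- riesz m & x.2 != 0]; split.
  by move=> x /mapP[y]; rewrite mem_filter => /andP[y0 _] ->.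
move=> N N0; exists (circ `&` [set t | h <= ev (tdil N (riesz_maj m)) t]); split.
- by apply: measurableI; [exact: measurable_circ|exact: measurable_ev_ge].
- apply: le_trans (markov_ev _ h0) _.
    by move=> t; rewrite ev_dil; have [] := ev_riesz_maj m (N%:~R * t).
  rewrite lee_fin ct_dil// ct_riesz_maj ler_pdivrMr// mulrC -ler_pdivlMr//.
  by rewrite (mulrC d).
- move=> t tc /= tE.
  have : ev (riesz_maj m) (N%:~R * t) < h.
    by rewrite ltNge; apply/negP => hh; apply: tE; split => //; rewrite /= ev_dil.
  set u := N%:~R * t => hu.
  have [r0 r1] := ev_riesz_maj m u.
  have -> : ev [seq (- x.1.1, x.1.2, x.2) | x <- riesz m & x.2 != 0] u = 1 - ev (riesz m) u.
    have -> : ev (riesz m) u = ct (riesz m) +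
        \sum_(x <- riesz m | x.2 != 0) x.1.1 * cos (x.2%:~R * u + x.1.2).
      rewrite /ev (bigID (fun x : R * R * int => x.2 == 0)) /=; congr (_ + _).
      by apply: eq_bigr => x /eqP ->; rewrite mul0r add0r.
    rewrite ct_riesz opprD addrA subrr sub0r /ev big_map big_filter -sumrN.
    by apply: eq_bigr => x _; rewrite mulNr.
  have -> : 1 - ev (riesz m) u - 1 = - ev (riesz m) u by ring.
  rewrite normrN ger0_norm ?ev_riesz_ge0// (le_trans r1)//.
  have h1 : h <= 1 by rewrite ge_min lexx orbT.
  have h2 : h <= d by rewrite ge_min lexx.
  by nra.
Qed.

End Gamma.

(** * Fourth moment of the maximal partial sum of a lacunary series *)

Section LacunaryMaximal.
Context {R : realType} (L : nat) (L_gt0 : (0 < L)%N).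

Let s (p : nat) : int := (L * 3 ^ p)%N%:Z.

Definition Csum (b l : nat) (v : R) : R := \sum_(p <- iota b l) cos ((s p)%:~R * v).
Definition Ssum (b l : nat) (v : R) : R := \sum_(p <- iota b l) sin ((s p)%:~R * v).
(** The squared modulus of the exponential sum with frequencies L * 3 ^ p, b <= p < b + l. *)
Definition zz (b l : nat) (v : R) : R := Csum b l v ^+ 2 + Ssum b l v ^+ 2.

Definition Z2 (b l : nat) : seq (R * R * int) :=
  [seq (1, 0, s p - s q) | p <- iota b l, q <- iota b l].
Definition Z4 (b l : nat) := tmul (Z2 b l) (Z2 b l).

(** A dyadic majorant, as in the Rademacher-Menshov inequality, for the fourth powers of all partial
    sums of length at most 2 ^ m. A longer sum is split at the midpoint; using [weighted_sqr] twice
    yields the weights 6 ^ 3 = 216 and (6 / 5) ^ 3 = 216 / 125. *)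
Fixpoint Maj (b m : nat) : seq (R * R * int) :=
  if m is m'.+1 then
    tscale (216 / 125) (Maj b m') ++ tscale (216 / 125) (Maj (b + 2 ^ m') m') ++
    tscale 216 (Z4 b (2 ^ m'))
  else Z4 b 1.

Lemma zz_ge0 b l v : 0 <= zz b l v.
Proof. by rewrite addr_ge0 ?sqr_ge0. Qed.

Lemma ev_Z2 b l v : ev (Z2 b l) v = zz b l v.
Proof.
rewrite /ev /Z2 big_allpairs_dep /zz /Csum /Ssum !expr2 !mulr_suml -big_split /=.
apply: eq_bigr => p _; rewrite !mulr_sumr -big_split /=; apply: eq_bigr => q _.
by rewrite mul1r addr0 rmorphB /= mulrBl cosB.
Qed.

Lemma ev_Z4 b l v : ev (Z4 b l) v = zz b l v ^+ 2.
Proof. by rewrite ev_mul ev_Z2 expr2. Qed.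

(** Two powers of 3 with exponents below d add up to less than 3 ^ d, so the larger exponents agree.
    This Sidon property leaves only diagonal terms in the fourth moment. *)
Lemma pow3_sum_inj (a b c d : nat) :
  (3 ^ a + 3 ^ b = 3 ^ c + 3 ^ d)%N -> (a = c /\ b = d) \/ (a = d /\ b = c).
Proof.
wlog ab : a b / (a <= b)%N => [hw|].
  by case: (leqP a b) => [/hw//|/ltnW ba]; rewrite addnC => /(hw _ _ ba) [[-> ->]|[-> ->]]; [right|left].
wlog cd : c d / (c <= d)%N => [hw|].
  by case: (leqP c d) => [/hw//|/ltnW dc]; rewrite [X in _ = X]addnC => /(hw _ _ dc) [[-> ->]|[-> ->]]; [right|left].
move=> e; left.
have pos k : (0 < 3 ^ k)%N by rewrite expn_gt0.
have [bd|db|bd] := ltngtP b d.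
- have : (3 ^ b.+1 <= 3 ^ d)%N by rewrite leq_exp2l.
  have : (3 ^ a <= 3 ^ b)%N by rewrite leq_exp2l.
  have := pos c; rewrite expnS; lia.
- have : (3 ^ d.+1 <= 3 ^ b)%N by rewrite leq_exp2l.
  have : (3 ^ c <= 3 ^ d)%N by rewrite leq_exp2l.
  have := pos a; rewrite expnS; lia.
- split=> //; subst d; move/eqP: e; rewrite eqn_add2r => /eqP e.
  by apply/eqP; rewrite -(@eqn_exp2l 3)//; apply/eqP.
Qed.

Let count1 (b l p : nat) : \sum_(q <- iota b l) (q == p)%:R <= 1 :> R.
Proof.
rewrite -natr_sum -[1]/(1%:R) ler_nat.
have -> : (\sum_(q <- iota b l) (q == p) = count_mem p (iota b l))%N.
  by rewrite -sum1_count [RHS]big_mkcond; apply: eq_bigr => q _ /=; case: eqP.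
by rewrite count_uniq_mem ?iota_uniq// leq_b1.
Qed.

Let quad (b l : nat) (P : nat -> nat -> nat -> nat -> bool) :
  (forall p q p' q', P p q p' q' -> (p = q /\ p' = q') \/ (p = q' /\ p' = q)) ->
  \sum_(p <- iota b l) \sum_(p' <- iota b l) \sum_(q <- iota b l) \sum_(q' <- iota b l)
     (P p q p' q')%:R <= 2 * (l%:R) ^+ 2 :> R.
Proof.
move=> h.
apply: (@le_trans _ _ (\sum_(p <- iota b l) \sum_(p' <- iota b l) 2)); last first.
  by rewrite !big_const_seq !iter_addr_0 !count_predT size_iota -mulrnA -(mulr_natr 2) natrM expr2.
apply: ler_sum => p _; apply: ler_sum => p' _.
apply: (@le_trans _ _ (\sum_(q <- iota b l) ((q == p)%:R + (q == p')%:R))); last first.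
  by rewrite big_split /= -[2]/(1 + 1) lerD.
apply: ler_sum => q _.
apply: (@le_trans _ _ (\sum_(q' <- iota b l) ((q == p)%:R * (q' == p')%:R + (q == p')%:R * (q' == p)%:R))).
  apply: ler_sum => q' _.
  case: (boolP (P p q p' q')) => [/h [[-> ->]|[-> ->]]|_].
  - by rewrite !eqxx mulr1 lerDl mulr_ge0.
  - by rewrite !eqxx mulr1 lerDr mulr_ge0.
  - by rewrite addr_ge0// mulr_ge0.
rewrite big_split /= -!mulr_sumr; apply: lerD; by rewrite ler_piMr// count1.
Qed.

Lemma ct_Z4 b l : ct (Z4 b l) <= 2 * l%:R ^+ 2.
Proof.
have s0 p q p' q' : (s p - s q + (s p' - s q') == 0) = (3 ^ p + 3 ^ p' == 3 ^ q + 3 ^ q')%N.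
  by apply/eqP/eqP; rewrite /s; [move=> h; have := L_gt0; nia|nia].
have s1 p q p' q' : (s p - s q - (s p' - s q') == 0) = (3 ^ p + 3 ^ q' == 3 ^ q + 3 ^ p')%N.
  by apply/eqP/eqP; rewrite /s; [move=> h; have := L_gt0; nia|nia].
pose S (P : nat -> nat -> nat -> nat -> bool) : R :=
  \sum_(p <- iota b l) \sum_(p' <- iota b l) \sum_(q <- iota b l) \sum_(q' <- iota b l)
     (P p q p' q')%:R.
have E (f : R * R * int -> R * R * int -> R) :
    \sum_(x <- Z2 b l) \sum_(y <- Z2 b l) f x y =
    \sum_(p <- iota b l) \sum_(p' <- iota b l) \sum_(q <- iota b l) \sum_(q' <- iota b l)
      f (1, 0, s p - s q) (1, 0, s p' - s q').
  rewrite big_allpairs_dep; apply: eq_bigr => p _; rewrite [RHS]exchange_big.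
  by apply: eq_bigr => q _; rewrite big_allpairs_dep.
have -> : ct (Z4 b l) =
    2^-1 * S (fun p q p' q' => 3 ^ p + 3 ^ p' == 3 ^ q + 3 ^ q')%N +
    2^-1 * S (fun p q p' q' => 3 ^ p + 3 ^ q' == 3 ^ q + 3 ^ p')%N.
  rewrite ct_cat /ct [X in X + _]big_mkcond [X in _ + X]big_mkcond big_allpairs_dep [X in _ + X]big_allpairs_dep !E /=.
  congr (_ + _); rewrite !mulr_sumr; apply: eq_bigr => p _; rewrite !mulr_sumr;
    apply: eq_bigr => p' _; rewrite !mulr_sumr; apply: eq_bigr => q _; rewrite !mulr_sumr;
    apply: eq_bigr => q' _.
    by rewrite s0 !addr0 cos0; case: ifP => _ /=; field.
  by rewrite s1 !subr0 cos0; case: ifP => _ /=; field.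
have := @quad b l (fun p q p' q' => 3 ^ p + 3 ^ p' == 3 ^ q + 3 ^ q')%N.
rewrite -/(S _) => h2.
have h1 : S (fun p q p' q' => 3 ^ p + 3 ^ q' == 3 ^ q + 3 ^ p')%N <= 2 * l%:R ^+ 2.
  rewrite (_ : S _ = S (fun p q p' q' => 3 ^ p + 3 ^ p' == 3 ^ q + 3 ^ q')%N) ?h2//.
    by move=> p q p' q' /eqP /pow3_sum_inj.
  (* Exchanging the roles of p' and q' turns one count into the other. *)
  rewrite /S; apply: eq_bigr => p _; rewrite exchange_big [RHS]exchange_big.
  by apply: eq_bigr => q _; exact: exchange_big.
have {}h2 : S (fun p q p' q' => 3 ^ p + 3 ^ p' == 3 ^ q + 3 ^ q')%N <= 2 * l%:R ^+ 2.
  by apply: h2 => p q p' q' /eqP /pow3_sum_inj.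
by lra.
Qed.

Lemma weighted_sqr (x y : R) : (x + y) ^+ 2 <= 6 * x ^+ 2 + 6 / 5 * y ^+ 2.
Proof.
rewrite -subr_ge0.
have -> : 6 * x ^+ 2 + 6 / 5 * y ^+ 2 - (x + y) ^+ 2 = (5 * x - y) ^+ 2 / 5 by field.
by rewrite divr_ge0// sqr_ge0.
Qed.

Lemma zz_split b k l v : zz b (k + l) v <= 6 * zz b k v + 6 / 5 * zz (b + k) l v.
Proof.
rewrite /zz /Csum /Ssum iotaD !big_cat /=.
have := weighted_sqr (\sum_(p <- iota b k) cos ((s p)%:~R * v)) (\sum_(p <- iota (b + k) l) cos ((s p)%:~R * v)).
have := weighted_sqr (\sum_(p <- iota b k) sin ((s p)%:~R * v)) (\sum_(p <- iota (b + k) l) sin ((s p)%:~R * v)).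
by lra.
Qed.

Lemma zz_le_Maj b m q v : (q <= 2 ^ m)%N -> zz b q v ^+ 2 <= ev (Maj b m) v.
Proof.
elim: m b q => [|m ih] b q /=.
  rewrite expn0; case: q => [|[|//]] _.
    by rewrite ev_Z4 /zz /Csum /Ssum !big_nil expr0n /= addr0 expr0n sqr_ge0.
  by rewrite ev_Z4.
rewrite expnS mul2n -addnn => qm; rewrite !ev_cat !ev_scale ev_Z4.
have [h|/ltnW h] := leqP q (2 ^ m).
  have := ih b q h; have := ih (b + 2 ^ m)%N 0%N isT.
  have := sqr_ge0 (zz b q v); have := sqr_ge0 (zz (b + 2 ^ m) 0 v); have := sqr_ge0 (zz b (2 ^ m) v).
  by lra.
have {qm} : (q - 2 ^ m <= 2 ^ m)%N by lia.
rewrite -{2}(subnKC h); move: (q - 2 ^ m)%N => l lm.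
have := ih (b + 2 ^ m)%N l lm; have := ih b 0%N isT.
have := sqr_ge0 (zz b 0 v); have := sqr_ge0 (zz (b + 2 ^ m) l v).
have := weighted_sqr (6 * zz b (2 ^ m) v) (6 / 5 * zz (b + 2 ^ m) l v).
have : zz b (2 ^ m + l) v ^+ 2 <= (6 * zz b (2 ^ m) v + 6 / 5 * zz (b + 2 ^ m) l v) ^+ 2.
  by rewrite ler_sqr ?zz_split// nnegrE ?zz_ge0// addr_ge0// mulr_ge0// zz_ge0.
set a := zz _ _ _; set c := zz _ _ _; set d := zz _ _ _; lra.
Qed.

(** The two halves contribute a growth factor 2 * 216 / 125 < 4, while the bound grows by 4 when the
    length doubles, so no logarithm is lost; 800 satisfies 800 * 432 / 125 + 432 <= 4 * 800. Second
    moments would allow only a factor 2, hence a weight below 1, which no splitting inequality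
    gives. *)
Lemma ct_Maj b m : ct (Maj b m) <= 800 * (2 ^ m)%:R ^+ 2.
Proof.
elim: m b => [|m ih] b /=.
  by rewrite expn0 expr1n (le_trans (ct_Z4 _ _))// expr1n; lra.
rewrite !ct_cat !ct_scale expnS natrM.
have := ih b; have := ih (b + 2 ^ m)%N; have := ct_Z4 b (2 ^ m).
have := sqr_ge0 ((2 ^ m)%:R : R); rewrite exprMn.
set x := _ ^+ 2; lra.
Qed.

End LacunaryMaximal.

(** * From lists of waves to series ordered by frequency *)

Section Regrouping.
Context {R : realType}.
Implicit Types (F : seq (R * R * int)) (t : R).

Definition upto (lam : nat -> int) n F := [seq y <- F | has (fun i => y.2 == lam i) (iota 0 n)].

(** Amplitudes are collected frequency by frequency. As [lam] is injective, cutting the series at n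
    amounts to discarding waves from the list. *)
Lemma regroup (lam : nat -> int) F : injective lam ->
  exists a b : nat -> R, forall n t,
    \sum_(0 <= i < n) (a i * cos ((lam i)%:~R * t) + b i * sin ((lam i)%:~R * t)) =
    ev (upto lam n F) t.
Proof.
move=> inj.
exists (fun i => \sum_(y <- F | y.2 == lam i) y.1.1 * cos y.1.2).
exists (fun i => - \sum_(y <- F | y.2 == lam i) y.1.1 * sin y.1.2) => n t.
rewrite /ev big_filter [RHS]big_mkcond /=.
transitivity (\sum_(0 <= i < n) \sum_(y <- F | y.2 == lam i) y.1.1 * cos (y.2%:~R * t + y.1.2)).
  apply: eq_bigr => i _; rewrite mulNr !mulr_suml -sumrB /=.
  by apply: eq_bigr => y /eqP ->; rewrite cosD; ring.
rewrite (eq_bigr (fun i => \sum_(y <- F)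
  if y.2 == lam i then y.1.1 * cos (y.2%:~R * t + y.1.2) else 0));
  last by move=> i _; rewrite big_mkcond.
rewrite exchange_big /=; apply: eq_bigr => y _.
rewrite /index_iota subn0; case: hasP => [[i ii /eqP yi]|h].
  rewrite (bigD1_seq i) ?iota_uniq//= yi eqxx big1 ?addr0// => j ji.
  by case: eqP => // /inj ij; rewrite ij eqxx in ji.
rewrite big_seq big1// => i ii; case: eqP => // yi.
by exfalso; apply: h; exists i => //; apply/eqP.
Qed.

Lemma nrm_filter (P : pred (R * R * int)) F : nrm [seq y <- F | P y] <= nrm F.
Proof.
rewrite /nrm big_filter big_mkcond; apply: ler_sum => y _.
by case: ifP.
Qed.

(** A cut at n meets at most one block, of which a sublist survives with [nrm] at most c; earlier
    blocks are whole and later ones absent. *)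
Lemma upto_blocks (lam : nat -> int) (s : nat -> nat) (L : nat)
    (Bl : nat -> seq (R * R * int)) (c : R) (M n : nat) :
  injective lam -> 0 <= c ->
  (forall p, (s p + L <= s p.+1)%N) ->
  (forall p, nrm (Bl p) <= c) ->
  (forall p y, y \in Bl p -> exists2 i, (s p <= i < s p + L)%N & y.2 = lam i) ->
  exists2 q, (q <= M)%N & forall t,
    `|ev (upto lam n (flatten [seq Bl p | p <- iota 0 M])) t -
      \sum_(p <- iota 0 q) ev (Bl p) t| <= c.
Proof.
move=> inj c0 sS hc hB.
have smono p q : (p <= q)%N -> (s p <= s q)%N.
  by apply: (@homo_leq _ s leq) => // [x y z|i]; [exact: leq_trans|have := sS i; lia].
elim: M => [|M [q qM hq]].
  by exists 0%N => // t; rewrite big_nil /= /ev big_nil subrr normr0.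
rewrite -[M.+1]addn1 iotaD map_cat flatten_cat /= cats0 add0n /upto filter_cat -/(upto _ _ _) -/(upto _ _ _).
have [nM|Mn] := leqP n (s M).
  exists q; first lia.
  suff -> : upto lam n (Bl M) = [::] by rewrite cats0.
  apply/eqP; rewrite /upto -(negbK (_ == _)) -has_filter; apply/negP => /hasP[y /hB[i iM yi]].
  move=> /hasP[j]; rewrite mem_iota yi => jn /eqP /inj ij; lia.
exists M; first lia.
move=> t; rewrite ev_cat.
have -> : upto lam n (flatten [seq Bl p | p <- iota 0 M]) = flatten [seq Bl p | p <- iota 0 M].
  apply/all_filterP/allP => y /flattenP[F0 /mapP[p]]; rewrite mem_iota => pM -> /hB[i ip yi].
  apply/hasP; exists i; last by apply/eqP.
  rewrite mem_iota; have := sS p; have := smono p.+1 M; lia.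
rewrite ev_flatten [X in X - _]addrC addrK (le_trans (ev_le_nrm _ _))// (le_trans (nrm_filter _ _))//.
Qed.

Lemma upto_all (lam : nat -> int) n F :
  (forall y, y \in F -> exists2 i, (i < n)%N & y.2 = lam i) -> upto lam n F = F.
Proof.
move=> h; apply/all_filterP/allP => y /h[i ip yi].
by apply/hasP; exists i; [rewrite mem_iota|apply/eqP].
Qed.

End Regrouping.

(** * Shifting all frequencies of a polynomial *)

Section Symmetrize.
Context {R : realType}.
Implicit Types (p : seq (R * R * int)) (t : R).

Definition tsym p := [seq (x.1.1 / 2, x.1.2, x.2) | x <- p] ++
  [seq (x.1.1 / 2, - x.1.2, - x.2) | x <- p].

Lemma nrm_sym p : nrm (tsym p) = nrm p.
Proof.
rewrite nrm_cat /nrm !big_map -big_split /=; apply: eq_bigr => x _.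
by rewrite normrM normfV (ger0_norm (ler0n _ 2)); field.
Qed.

Lemma mem_sym p x : x \in tsym p -> (`|x.2| <= deg p)%N.
Proof.
rewrite mem_cat => /orP[] /mapP[y /mem_deg yp ->] //=.
by rewrite abszN.
Qed.

(* The conjugate sum over a symmetrized list vanishes, so shifting all its
   frequencies by N amounts to multiplication by cos (N t). *)
Lemma ev_sym_shift p (u t : R) :
  \sum_(x <- tsym p) x.1.1 * cos (u + (x.2%:~R * t + x.1.2)) = cos u * ev p t.
Proof.
rewrite big_cat /= !big_map -big_split /= /ev mulr_sumr; apply: eq_bigr => x _.
rewrite rmorphN /= mulNr -opprD [in LHS]cosD cosB; by field.
Qed.

End Symmetrize.

(** * The labelled progression of shifted squares *)

Section Labels.
Context (D dg B K : nat) (B_prime : prime B) (dgB : (dg < B)%N).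

(** The largest offset B ^ (r + D) * |n| with |r| <= D and |n| <= dg, that is, the half-width of a
    block. *)
Definition hw : nat := (B ^ (2 * D) * dg)%N.
Definition bw : nat := (2 * hw).+1.

(* In a block of bw consecutive squares, the offset from the center is
   B ^ (r + D) * n with 0 < |n| < B, so that the label r is read off from a
   B-adic valuation. *)
Definition lab (i : nat) : int :=
  let rho := logn B `|(i %% bw)%N%:Z - hw%:Z|%N in
  if (rho <= 2 * D)%N then rho%:Z - D%:Z else 0.

(** Expanding the square gives K ^ 2 + 2 K i + lab i: the term - i ^ 2 straightens the squares into
    a progression of step 2 K, perturbed by the label. The shift itself does not involve K. *)
Definition lam (i : nat) : int := (K%:Z + i%:Z) ^+ 2 + (lab i - i%:Z ^+ 2).

(** The unlabelled progression at the center i = bw * 3 ^ p + hw of the p-th block. Up to a common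
    translation, the centers are lacunary with ratio 3. *)
Definition drive (p : nat) : int := K%:Z ^+ 2 + 2 * K%:Z * ((bw * 3 ^ p)%N%:Z + hw%:Z).
Arguments drive : simpl never.

Lemma lab_le i : (`|lab i| <= D)%N.
Proof. by rewrite /lab; case: ifP => [|_]; [move: (logn _ _) => n; lia|]. Qed.

(** Since 0 < |n| < B with B prime, the offset B ^ (r + D) * n has B-adic valuation exactly r + D;
    the label at this offset is therefore r, the very term to be added to the progression. *)
Lemma lamE p (r n : int) : (`|r| <= D)%N -> n != 0 -> (`|n| <= dg)%N ->
  exists2 i, (bw * 3 ^ p <= i < bw * 3 ^ p + bw)%N &
    drive p + r + 2 * K%:Z * (B ^ `|(r + D%:Z)%R|)%N%:Z * n = lam i.
Proof.
move=> rD n0 ng; set rho := `|(r + D%:Z)%R|%N.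
have rhoD : (rho <= 2 * D)%N by rewrite /rho; lia.
have hB : (B ^ rho <= B ^ (2 * D))%N by rewrite leq_exp2l// prime_gt1.
have oH : (B ^ rho * `|n| <= hw)%N by exact: leq_mul.
set o := (B ^ rho)%N%:Z * n.
have oE : `|o|%N = (B ^ rho * `|n|)%N by rewrite abszM absz_nat.
pose k := `|(hw%:Z + o)%R|%N.
have kE : k%:Z = hw%:Z + o by rewrite /k; lia.
have kL : (k < bw)%N by rewrite /bw; lia.
exists (bw * 3 ^ p + k)%N; first by rewrite leq_addr ltn_add2l.
rewrite /lam.
have -> : lab (bw * 3 ^ p + k) = r.
  rewrite /lab mulnC modnMDl modn_small// kE.
  have -> : hw%:Z + o - hw%:Z = o by ring.
  rewrite oE lognM ?absz_gt0 ?expn_gt0 ?prime_gt0// pfactorK//.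
  rewrite (_ : logn B `|n| = 0%N).
    by rewrite addn0 rhoD /rho; lia.
  apply/eqP; rewrite eqn0Ngt logn_gt0 mem_primes B_prime absz_gt0 n0 /=.
  by rewrite gtnNdvd ?absz_gt0//; lia.
have -> : 2 * K%:Z * (B ^ rho)%N%:Z * n = 2 * K%:Z * o by rewrite /o mulrA.
by rewrite /drive PoszD kE; ring.
Qed.

Context (DK : (D < K)%N).

(** Terms of the progression are at least 2 K apart, and two labels differ by at most 2 D < 2 K. *)
Lemma lam_lt i j : (i < j)%N -> lam i < lam j.
Proof.
move=> ij; have := lab_le i; have := lab_le j; rewrite /lam.
move: (lab i) (lab j) => a b; nia.
Qed.

Lemma lam_inj : injective lam.
Proof.
move=> i j e; case: (ltngtP i j) => // /lam_lt; by rewrite e ltxx.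
Qed.

End Labels.

(** * Blocks realizing a drive frequency times a polynomial *)

Section Block.
Context {R : realType} (D dg B K : nat).
Let L := bw D dg B.
Let Np (p : nat) : int := drive D dg B K p.
Context (kappa : R) (g e : seq (R * R * int)).

(** Each wave of [e], moved to the drive frequency, is multiplied by its own dilation of [g], which
    sends it to the offsets labelled by its frequency. *)
Definition blk (p : nat) : seq (R * R * int) :=
  flatten [seq tmul [:: (kappa * x.1.1, x.1.2, Np p + x.2)]
                    (tdil (2 * K%:Z * (B ^ `|(x.2 + D%:Z)%R|)%N%:Z) g) | x <- e].

Lemma nrm_blk p : nrm (blk p) = `|kappa| * nrm e * nrm g.
Proof.
rewrite nrm_flatten -mulrA [nrm e * _]mulr_suml mulr_sumr; apply: eq_bigr => x _.
by rewrite nrm_mul nrm_dil {1}/nrm big_seq1 normrM mulrA.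
Qed.

Lemma ev_blk p t : ev (blk p) t = kappa * \sum_(x <- e) x.1.1 *
  cos ((Np p)%:~R * t + (x.2%:~R * t + x.1.2)) *
  ev g ((2 * K%:Z * (B ^ `|(x.2 + D%:Z)%R|)%N%:Z)%:~R * t).
Proof.
rewrite ev_flatten mulr_sumr; apply: eq_bigr => x _.
rewrite ev_mul ev_dil {1}/ev big_seq1 /= rmorphD /= mulrDl -addrA.
by rewrite !mulrA.
Qed.

Lemma mem_blk p y : prime B -> (dg < B)%N ->
  (forall x, x \in e -> (`|x.2| <= D)%N) ->
  (forall x, x \in g -> x.2 != 0 /\ (`|x.2| <= dg)%N) -> y \in blk p ->
  exists2 i, (L * 3 ^ p <= i < L * 3 ^ p + L)%N & y.2 = lam D dg B K i.
Proof.
move=> pB dB he hg /flattenP[F0 /mapP[x /he xe ->]].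
rewrite mem_cat => /orP[] /allpairsP[[u v] /= [/[!inE]/eqP -> /mapP[z /hg[z0 zg] ->] ->]] /=.
  by have [i ip e'] := @lamE D dg B K pB dB p x.2 z.2 xe z0 zg; exists i => //; rewrite -e' addrA.
have [||i ip e'] := @lamE D dg B K pB dB p x.2 (- z.2) xe.
- by rewrite oppr_eq0.
- by rewrite abszN.
- by exists i => //; rewrite -e'; ring.
Qed.

(** A sum of cosines with a common phase is a projection of the exponential sum onto a direction,
    hence bounded by its modulus. The part of [drive] that is independent of p joins the phase. *)
Lemma zz_drive (t th : R) q :
  (\sum_(p <- iota 0 q) cos ((Np p)%:~R * t + th)) ^+ 2 <= zz L 0 q ((2 * K%:Z)%:~R * t).
Proof.
set v := _ * t; set al := (K%:Z ^+ 2 + 2 * K%:Z * (hw D dg B)%:Z)%:~R * t + th.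
have -> : \sum_(p <- iota 0 q) cos ((Np p)%:~R * t + th) =
    cos al * Csum L 0 q v - sin al * Ssum L 0 q v.
  rewrite !mulr_sumr -sumrB; apply: eq_bigr => p _; rewrite -cosD; congr cos.
  rewrite /al /v /Np /drive -/L !(rmorphD, rmorphM) /= rmorphXn /=; ring.
rewrite /zz -subr_ge0; set x := Csum _ _ _ _; set y := Ssum _ _ _ _.
have -> : x ^+ 2 + y ^+ 2 - (cos al * x - sin al * y) ^+ 2 = (sin al * x + cos al * y) ^+ 2.
  by have := cos2Dsin2 al => h; rewrite -[x ^+ 2 + y ^+ 2]mul1r -h; ring.
exact: sqr_ge0.
Qed.

End Block.

Section BlockSum.
Context {R : realType} (D dg B K : nat).
Let Np (p : nat) : int := drive D dg B K p.

(** With [g] equal to 1 the identity would be exact by [ev_sym_shift]. Each wave costs an error d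
    times a driving sum carrying the phase of that wave, which is why c must be uniform in th. *)
Lemma block_sum (kappa c d : R) (g r : seq (R * R * int)) q t :
  0 <= kappa -> 0 <= d ->
  (forall x, x \in tsym r -> `|ev g ((2 * K%:Z * (B ^ `|(x.2 + D%:Z)%R|)%N%:Z)%:~R * t) - 1| <= d) ->
  (forall th, `|\sum_(p <- iota 0 q) cos ((Np p)%:~R * t + th)| <= c) ->
  `|\sum_(p <- iota 0 q) ev (blk D dg B K kappa g (tsym r) p) t -
    kappa * (\sum_(p <- iota 0 q) cos ((Np p)%:~R * t)) * ev r t| <= kappa * nrm r * d * c.
Proof.
move=> k0 d0 hg hc.
have -> : \sum_(p <- iota 0 q) ev (blk D dg B K kappa g (tsym r) p) t -
    kappa * (\sum_(p <- iota 0 q) cos ((Np p)%:~R * t)) * ev r t =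
  kappa * \sum_(x <- tsym r) x.1.1 *
    (ev g ((2 * K%:Z * (B ^ `|(x.2 + D%:Z)%R|)%N%:Z)%:~R * t) - 1) *
    \sum_(p <- iota 0 q) cos ((Np p)%:~R * t + (x.2%:~R * t + x.1.2)).
  rewrite -mulrA mulr_suml.
  rewrite (eq_bigr (fun p => kappa * \sum_(x <- tsym r) x.1.1 *
      cos ((Np p)%:~R * t + (x.2%:~R * t + x.1.2)) *
      ev g ((2 * K%:Z * (B ^ `|(x.2 + D%:Z)%R|)%N%:Z)%:~R * t))); last first.
    by move=> p _; rewrite ev_blk.
  rewrite -mulr_sumr -mulrBr -sumrB; congr (_ * _).
  under eq_bigr => p _ do rewrite -ev_sym_shift -sumrB.
  rewrite exchange_big /=; apply: eq_bigr => x _.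
  by rewrite mulr_sumr; apply: eq_bigr => p _; ring.
rewrite normrM (ger0_norm k0) -!mulrA ler_wpM2l// (le_trans (ler_norm_sum _ _ _))//.
rewrite -(nrm_sym r) /nrm mulr_suml big_seq [leRHS]big_seq; apply: ler_sum => x xr.
by rewrite !normrM -mulrA ler_wpM2l// ler_pM// hg.
Qed.

End BlockSum.

(** * One level: realizing W times a polynomial in a window *)

Section Level.
Context {R : realType}.
Local Notation tp := (seq (R * R * int)).
Local Notation mu := (@lebesgue_measure R).

Definition gap (K : nat) (p : tp) := forall x, x \in p -> x.2 = 0 \/ (K <= `|x.2|)%N.

(** W is not bounded by 1, so the bound must hold on the whole line: v ^ 4 takes over for large |v|,
    and - v ^ 2 / 16 brings the mean below 1. *)
Lemma sqrt_majorant2 (v : R) : let g := 1 + v / 2 - v ^+ 2 / 16 + v ^+ 4 / 4 in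
  0 <= g /\ `|1 + v| <= g ^+ 2.
Proof.
move=> g; rewrite /g; split.
  have -> : 1 + v / 2 - v ^+ 2 / 16 + v ^+ 4 / 4 =
    (v ^+ 2 - 1) ^+ 2 / 4 + (v + 4 / 7) ^+ 2 * (7 / 16) + (3 / 4 - 1 / 7) :> R by field.
  by have := sqr_ge0 (v ^+ 2 - 1); have := sqr_ge0 (v + 4 / 7); lra.
set h := v / 2 - v ^+ 2 / 16 + v ^+ 4 / 4.
have -> : 1 + v / 2 - v ^+ 2 / 16 + v ^+ 4 / 4 = 1 + h by rewrite /h; ring.
have gE : (1 + h) ^+ 2 = 1 + v + v ^+ 2 *
    ((1 / 2 - v / 16 + v ^+ 3 / 4) ^+ 2 - 1 / 8 + v ^+ 2 / 2) by rewrite /h; field.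
have [v1|v1] := leP (-1) v.
  rewrite ger0_norm; last by lra.
  rewrite gE lerDl mulr_ge0 ?sqr_ge0//.
  have [v2|v2] := leP (1 / 4) (v ^+ 2).
    by have := sqr_ge0 (1 / 2 - v / 16 + v ^+ 3 / 4); lra.
  have va : - (1 / 2) <= v <= 1 / 2 by apply/andP; split; nra.
  have [va1 va2] := andP va.
  have v3 : - (1 / 8) <= v ^+ 3 by nra.
  have : 7 / 16 <= 1 / 2 - v / 16 + v ^+ 3 / 4 by lra.
  by move: (1 / 2 - v / 16 + v ^+ 3 / 4) => x; have := sqr_ge0 v; nra.
have hu : - v / 2 <= 1 + h.
  have -> : 1 + h = - v / 2 + ((v ^+ 2 - 3 / 2) ^+ 2 / 4 +
    (11 / 16) * (v + 8 / 11) ^+ 2 + (7 / 16 - 4 / 11)) by rewrite /h; field.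
  by have := sqr_ge0 (v ^+ 2 - 3 / 2); have := sqr_ge0 (v + 8 / 11); lra.
rewrite ltr0_norm; last by lra.
rewrite (@le_trans _ _ ((- v / 2) ^+ 2))//.
  by have := sqr_ge0 (v / 2 + 1); nra.
by rewrite ler_sqr ?nnegrE//; lra.
Qed.

Section FixedLevel.
Context (D dg B K : nat) (B_prime : prime B) (dgB : (dg < B)%N) (DK : (D < K)%N).
Context (m : nat).
Let L := bw D dg B.
Let M : nat := (2 ^ (2 * m))%N.
Let Np (p : nat) : int := drive D dg B K p.
(** Normalized by kappa ^ 2 * M = 1 / 64: as m grows a single block becomes negligible, but the
    variance of W stays the same. *)
Let kappa : R := 8^-1 / 2 ^+ m.

Definition levW : tp := [seq (kappa, 0, Np p) | p <- iota 0 M].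
(** The majorant of [sqrt_majorant2] at v = W, with v ^ 4 replaced by the larger kappa ^ 4 times
    [Z4], whose mean is bounded by [ct_Z4]. *)
Definition levG : tp := tone ++ tscale 2^-1 levW ++ tscale (- 16^-1) (tmul levW levW) ++
  tscale (kappa ^+ 4 / 4) (tdil (2 * K%:Z) (Z4 L 0 M)).
(** Dominates kappa times every partial driving sum, whatever its phase; the factor M ^ -2 brings
    the maximal term to mean at most 800. *)
Definition levQ : tp := tscale 2 tone ++
  tscale (M%:R ^- 2) (tdil (2 * K%:Z) (Maj L 0 (2 * m))).

Lemma bw_gt0 : (0 < L)%N. Proof. by []. Qed.

Lemma kappa_ge0 : 0 <= kappa. Proof. by rewrite divr_ge0// exprn_ge0. Qed.

Lemma kappaM : kappa ^+ 2 * M%:R = 64^-1.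
Proof.
rewrite /kappa /M natrX mulnC exprM; have : 2 ^+ m != 0 :> R by rewrite expf_neq0.
by move: (2 ^+ m) => x x0; field.
Qed.

Lemma M_gt0 : 0 < M%:R :> R. Proof. by rewrite ltr0n expn_gt0. Qed.

Lemma ev_levW t : ev levW t = kappa * \sum_(p <- iota 0 M) cos ((Np p)%:~R * t).
Proof. by rewrite /ev big_map mulr_sumr; apply: eq_bigr => p _; rewrite addr0. Qed.

Lemma Np_ge p : K%:Z <= Np p.
Proof. by rewrite /Np /drive; nia. Qed.

Lemma gap_cat p q : gap K p -> gap K q -> gap K (p ++ q).
Proof. by move=> hp hq x; rewrite mem_cat => /orP[/hp|/hq]. Qed.

Lemma gap_scale c p : gap K p -> gap K (tscale c p).
Proof. by move=> hp x /mapP[y /hp yp ->]. Qed.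

Lemma gap_tone : gap K tone.
Proof. by move=> x; rewrite inE => /eqP ->; left. Qed.

Lemma gap_dil p : gap K (tdil (2 * K%:Z) p).
Proof.
move=> x /mapP[y _ ->] /=; have [->|y0] := eqVneq y.2 0; first by left; rewrite mulr0.
by right; move: y.2 y0 => n n0; nia.
Qed.

Lemma gap_levW : gap K levW.
Proof. move=> x /mapP[p _ ->]; right; have : K%:Z <= (kappa, 0 : R, Np p).2 by exact: Np_ge.
by move: (_.2) => n; lia. Qed.

Lemma gap_levWW : gap K (tmul levW levW).
Proof.
move=> x; rewrite mem_cat => /orP[] /allpairsP[[u v] /= [/mapP[p _ ->] /mapP[q _ ->] ->]].
  have h : (K <= `|(Np p + Np q)%R|)%N.
    by have := Np_ge p; have := Np_ge q; move: (Np p) (Np q) => a b; lia.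
  by right; exact: h.
suff h : Np p - Np q = 0 \/ (K <= `|(Np p - Np q)%R|)%N by exact: h.
have -> : Np p - Np q = 2 * K%:Z * ((L * 3 ^ p)%N%:Z - (L * 3 ^ q)%N%:Z).
  by rewrite /Np /drive -/L; ring.
by move: (_ - _) => n; have [->|n0] := eqVneq n 0; [left; rewrite mulr0|right; nia].
Qed.

Lemma gap_levG : gap K levG.
Proof.
apply: gap_cat; first exact: gap_tone.
apply: gap_cat; first by apply: gap_scale; exact: gap_levW.
apply: gap_cat; first by apply: gap_scale; exact: gap_levWW.
by apply: gap_scale; exact: gap_dil.
Qed.

Lemma gap_levQ : gap K levQ.
Proof.
apply: gap_cat; first by apply: gap_scale; exact: gap_tone.
by apply: gap_scale; exact: gap_dil.
Qed.

Let K2 : 2 * K%:Z != 0. Proof. by rewrite mulf_neq0// -lt0n (leq_trans _ DK). Qed.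

Lemma levW_le t q : (kappa * \sum_(p <- iota 0 q) cos ((Np p)%:~R * t)) ^+ 2 <=
  kappa ^+ 2 * zz L 0 q ((2 * K%:Z)%:~R * t).
Proof.
rewrite exprMn ler_wpM2l ?sqr_ge0//.
have := zz_drive D dg B K t 0 q; rewrite -/L => /(le_trans _); apply.
by rewrite (eq_bigr (fun p => cos ((drive D dg B K p)%:~R * t + 0)))// => p _; rewrite addr0.
Qed.

Lemma ev_levG t : 0 <= ev levG t /\ `|1 + ev levW t| <= ev levG t ^+ 2.
Proof.
have [g0 g1] := sqrt_majorant2 (ev levW t).
suff hg : 1 + ev levW t / 2 - ev levW t ^+ 2 / 16 + ev levW t ^+ 4 / 4 <= ev levG t.
  split; first exact: le_trans hg.
  by rewrite (le_trans g1)// ler_sqr ?nnegrE// (le_trans g0).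
rewrite /levG !ev_cat !ev_scale ev_mul ev_one ev_dil ev_Z4.
have h : ev levW t ^+ 4 <= kappa ^+ 4 * zz L 0 M ((2 * K%:Z)%:~R * t) ^+ 2.
  have := levW_le t M; rewrite -ev_levW => h.
  rewrite (_ : 4 = 2 * 2)%N// !exprM -exprMn ler_sqr ?nnegrE ?sqr_ge0//.
  by rewrite mulr_ge0 ?sqr_ge0 ?zz_ge0.
by rewrite -expr2; move: (zz _ _ _ _) h => z h; lra.
Qed.

Lemma ct_levW : ct levW = 0.
Proof.
rewrite /ct big_map big1// => p /eqP e.
by have := Np_ge p; rewrite [Np p]e; lia.
Qed.

Lemma ct_levWW : 128^-1 <= ct (tmul levW levW).
Proof.
rewrite /tmul ct_cat /ct big_mkcond big_allpairs_dep [X in _ + X]big_mkcond big_allpairs_dep /= !big_map.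
rewrite (@le_trans _ _ (0 + \sum_(p <- iota 0 M) kappa ^+ 2 / 2))//.
  rewrite add0r big_const_seq count_predT size_iota iter_addr addr0.
  have -> : kappa ^+ 2 / 2 *+ M = kappa ^+ 2 * M%:R / 2.
    by rewrite -[LHS]mulr_natr mulrAC.
  by rewrite kappaM; lra.
have t0 (x : bool) : 0 <= (if x then kappa * kappa / 2 else 0).
  by case: x => //; rewrite !mulr_ge0 ?kappa_ge0.
rewrite lerD//.
  rewrite sumr_ge0// => p _; rewrite big_map big_mkcond sumr_ge0// => q _ /=.
  by rewrite addr0 cos0 mulr1 t0.
rewrite big_seq [leRHS]big_seq; apply: ler_sum => p pM; rewrite big_map big_mkcond /=.
rewrite (bigD1_seq p)//= ?iota_uniq// subrr eqxx subr0 cos0 mulr1 -expr2 lerDl.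
by rewrite sumr_ge0// => q _; rewrite t0.
Qed.

(** The quadratic term contributes at most - (1 / 16) (1 / 128) = - 4 / 8192 and the quartic one at
    most (1 / 64) ^ 2 / 2 = 1 / 8192. *)
Lemma ct_levG : ct levG <= 1 - 3 / 8192.
Proof.
rewrite /levG !ct_cat !ct_scale ct_one ct_levW ct_dil//.
have h1 := ct_levWW; have h2 := @ct_Z4 R L bw_gt0 0 M.
have h3 : kappa ^+ 4 / 4 * ct (Z4 L 0 M) <= 8192^-1.
  rewrite (@le_trans _ _ (kappa ^+ 4 / 4 * (2 * M%:R ^+ 2)))//.
    by rewrite ler_wpM2l// divr_ge0// exprn_ge0// kappa_ge0.
  rewrite (_ : _ * _ = (kappa ^+ 2 * M%:R) ^+ 2 / 2); last by field.
  by rewrite kappaM; lra.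
by lra.
Qed.

Lemma zz_le_levQ t q : (q <= M)%N ->
  (zz L 0 q ((2 * K%:Z)%:~R * t) / M%:R) ^+ 2 + 2 <= ev levQ t.
Proof.
move=> qM; rewrite /levQ ev_cat !ev_scale ev_one ev_dil.
have := zz_le_Maj bw_gt0 0 ((2 * K%:Z)%:~R * t) qM.
rewrite mulr1 addrC lerD2l expr_div_n => h; rewrite [leLHS]mulrC.
by rewrite ler_wpM2l// invr_ge0 exprn_ge0.
Qed.

Lemma ev_levQ t : 2 <= ev levQ t.
Proof. by apply: le_trans (zz_le_levQ t (leq0n M)); rewrite lerDr sqr_ge0. Qed.

Lemma ct_levQ : ct levQ <= 802.
Proof.
rewrite /levQ ct_cat !ct_scale ct_one ct_dil//.
have := @ct_Maj R L bw_gt0 0 (2 * m) => h.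
have : (M%:R : R) ^- 2 * ct (Maj L 0 (2 * m)) <= 800.
  by rewrite ler_pdivrMl ?exprn_gt0 ?M_gt0// mulrC.
by lra.
Qed.

Lemma drive_sum_le t th q : (q <= M)%N ->
  kappa * `|\sum_(p <- iota 0 q) cos ((Np p)%:~R * t + th)| <= ev levQ t - 1.
Proof.
move=> qM; have h := zz_le_levQ t qM.
have h2 := zz_drive D dg B K t th q; rewrite -/L in h2.
have k2 : kappa ^+ 2 = 64^-1 / M%:R by rewrite -kappaM mulfK// gt_eqF// M_gt0.
set S := \sum_(p <- _) _ in h2 *.
set x := kappa * `|S|; have x0 : 0 <= x by rewrite mulr_ge0// kappa_ge0.
have x2 : x ^+ 2 <= zz L 0 q ((2 * K%:Z)%:~R * t) / M%:R.
  rewrite exprMn k2 real_normK ?num_real// mulrAC -mulrA.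
  rewrite (@le_trans _ _ (1 * (S ^+ 2 / M%:R)))//; first by rewrite ler_wpM2r ?divr_ge0 ?sqr_ge0//; lra.
  by rewrite mul1r ler_wpM2r// invr_ge0.
(* The chain is x <= (x ^ 2 + 1) / 2 <= (z + 1) / 2 <= z ^ 2 + 1. *)
by move: (zz _ _ _ _ / _) x2 h => z x2 h; have := sqr_ge0 (x - 1); have := sqr_ge0 (z - 1 / 4); lra.
Qed.

(** Two errors occur: kappa * nrm r * nrm g for the block that is cut, and nrm r * d * A for
    replacing [g] by 1. The driving sums give the factor Q - 1; it is weakened to Q ^ 2 - 1, the
    form that passes from level to level. *)
Lemma level_sums (d : R) (g r : tp) (A : R) :
  0 <= d -> (deg r <= D)%N ->
  (forall x, x \in g -> x.2 != 0 /\ (`|x.2| <= dg)%N) ->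
  exists a b : nat -> R, forall t,
    let u n := \sum_(0 <= i < n) (a i * cos ((lam D dg B K i)%:~R * t) +
                                 b i * sin ((lam D dg B K i)%:~R * t)) in
    (forall rho, (rho <= 2 * D)%N -> `|ev g ((2 * K%:Z * (B ^ rho)%N%:Z)%:~R * t) - 1| <= d) ->
    ev levQ t <= A ->
    (forall n, `|u n| <= `|ev r t| * (ev levQ t ^+ 2 - 1) +
                        (kappa * nrm r * nrm g + nrm r * d * A)) /\
    `|u (L * 3 ^ M)%N - ev levW t * ev r t| <= nrm r * d * A.
Proof.
move=> d0 rD hg; pose e := tsym r.
pose F : tp := flatten [seq blk D dg B K kappa g e p | p <- iota 0 M].
have [a [b ab]] := regroup F (lam_inj B_prime dgB DK).
exists a, b => t u ht hA.
have eD x : x \in e -> (`|x.2| <= D)%N by move=> /mem_sym xr; rewrite (leq_trans xr).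
have memb p y : y \in blk D dg B K kappa g e p ->
  exists2 i, (L * 3 ^ p <= i < L * 3 ^ p + L)%N & y.2 = lam D dg B K i.
  exact: mem_blk.
have c0 : 0 <= kappa * nrm r * nrm g by rewrite !mulr_ge0 ?nrm_ge0 ?kappa_ge0.
have hq q : (q <= M)%N -> `|\sum_(p <- iota 0 q) ev (blk D dg B K kappa g e p) t -
    kappa * (\sum_(p <- iota 0 q) cos ((Np p)%:~R * t)) * ev r t| <= nrm r * d * A.
  move=> qM.
  have [k0|k0] := eqVneq kappa 0.
    have := kappaM; rewrite k0 expr0n mul0r => /eqP; rewrite eq_sym invr_eq0 => /eqP; lra.
  have kp : 0 < kappa by rewrite lt_neqAle eq_sym k0 kappa_ge0.
  have := @block_sum R D dg B K kappa (kappa^-1 * A) d g r q t kappa_ge0 d0 => /(_ _ _)/le_trans; apply.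
  - move=> x xe; apply: ht; have := eD x xe; lia.
  - move=> th; rewrite ler_pdivlMl//.
    by rewrite (le_trans (drive_sum_le t th qM))// (le_trans _ hA)// gerBl.
  - by rewrite (_ : _ * _ = nrm r * d * A)//; field.
split=> [n|]; last first.
  rewrite /u ab upto_all; last first.
    move=> y /flattenP[_ /mapP[p pM ->] /memb[i ip yi]]; exists i => //.
    rewrite mem_iota in pM.
    have : (3 ^ p.+1 <= 3 ^ M)%N by rewrite leq_exp2l//; lia.
    by rewrite expnS; have := expn_gt0 3 p; move: (3 ^ p)%N (3 ^ M)%N ip => x z; clear; nia.
  by rewrite ev_flatten ev_levW; exact: hq.
have sL p : (L * 3 ^ p + L <= L * 3 ^ p.+1)%N.
  by rewrite expnS; have := expn_gt0 3 p; move: (3 ^ p)%N L => x l; clear; nia.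
have nB p : nrm (blk D dg B K kappa g e p) <= kappa * nrm r * nrm g.
  by rewrite nrm_blk nrm_sym ger0_norm// kappa_ge0.
have [q qM hu] := @upto_blocks R (lam D dg B K) (fun p => (L * 3 ^ p)%N) L
  (blk D dg B K kappa g e) (kappa * nrm r * nrm g) M n (lam_inj B_prime dgB DK) c0 sL nB memb.
rewrite /u ab.
have h1 := hu t; have h2 := hq q qM; have h3 := drive_sum_le t 0 qM; have h4 := ev_levQ t.
have h5 : `|kappa * (\sum_(p <- iota 0 q) cos ((Np p)%:~R * t)) * ev r t| <=
    `|ev r t| * (ev levQ t ^+ 2 - 1).
  rewrite normrM mulrC ler_wpM2l// normrM (ger0_norm kappa_ge0).
  rewrite (eq_bigr (fun p => cos ((Np p)%:~R * t + 0))); last by move=> p _; rewrite addr0.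
  by rewrite (le_trans h3)//; nra.
move: h1 h2 h5; rewrite -/F; move: (ev (upto _ _ _) t) (\sum_(p <- _) _) (_ * ev r t) (_ * (_ - 1)).
move=> x y z w; rewrite !ler_distl ler_norml ler_norml; lra.
Qed.

End FixedLevel.

(* The shifts rr and their bound C are chosen before the position K of the window;
   as ct G <= gam < 1, the product of the factors 1 + W over many levels is small in
   measure. *)
Definition level_property (gam c : R) := forall (D : nat) (nu e : R), 0 <= nu -> 0 < e ->
  exists (J C : nat) (rr : nat -> int), (forall i, (i < J)%N -> (`|rr i| <= C)%N) /\
  forall K, (D < K)%N -> exists (W G Q : tp) (E : set R),
  [/\ measurable E /\ (mu E <= e%:E)%E, gap K G /\ gap K Q,
      (forall t, 0 <= ev G t /\ `|1 + ev W t| <= ev G t ^+ 2) /\ ct G <= gam,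
      (forall t, 2 <= ev Q t) /\ ct Q <= c &
  forall r : tp, (deg r <= D)%N -> nrm r <= nu ->
  exists a b : nat -> R, forall t, circ t -> ~ E t ->
    let lambda i := (K%:Z + i%:Z) ^+ 2 + rr i in
    let u n := \sum_(0 <= i < n) (a i * cos ((lambda i)%:~R * t) +
                                 b i * sin ((lambda i)%:~R * t)) in
    (forall n, `|u n| <= `|ev r t| * (ev Q t ^+ 2 - 1) + e) /\
    `|u J - ev W t * ev r t| <= e].

(** The choices come in the order A, d, g, B, m, none involving K. A bounds Q off a small set; d
    pays for the error nu * d * A and for 2 D + 1 exceptional sets, one for each exponent r + D; m
    makes a single block small. *)
Lemma level : exists gam c : R, [/\ 0 < gam, gam < 1, 0 < c & level_property gam c].
Proof.
exists (1 - 3 / 8192), 802; split; [lra|lra|lra|] => D nu e nu0 e0.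
pose A : R := 1 + pi *+ 2 * 802 * 2 / e.
have pi0 : 0 < pi *+ 2 :> R by rewrite pmulrn_lgt0// pi_gt0.
have P0 : 0 <= pi *+ 2 * 802 :> R by exact: mulr_ge0 (ltW pi0) (ler0n _ _).
have A0 : 0 < A.
  by apply: ltr_pwDl ltr01 _; apply: divr_ge0 (ltW e0); exact: mulr_ge0 P0 (ler0n _ _).
have S0 : 0 < nu * A + D.*2.+1%:R :> R by rewrite ltr_wpDl// mulr_ge0// ltW.
pose d := e / 2 / (nu * A + D.*2.+1%:R).
have d0 : 0 < d by rewrite !divr_gt0.
have dE : nu * d * A + D.*2.+1%:R * d = e / 2 by rewrite mulrAC -mulrDl mulrC divfK// gt_eqF.
have [g [g0 hg]] := gamma_exists d0.
have [B dgB pB] := prime_above (deg g).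
have ng0 := nrm_ge0 g.
have T0 : 0 < nu * nrm g + 1 by rewrite ltr_wpDl// mulr_ge0.
have [m hm] := @pow_small R 2^-1 (e / 2 / (nu * nrm g + 1)) ltac:(apply/andP; split; lra)
  ltac:(by rewrite !divr_gt0).
pose L := bw D (deg g) B; pose J := (L * 3 ^ (2 ^ (2 * m)))%N.
exists J, (D + J ^ 2)%N, (fun i => lab D (deg g) B i - i%:Z ^+ 2); split.
  move=> i iJ; have := lab_le D pB dgB i; move: (lab _ _ _ _) J iJ => x J iJ xD.
  have : (i ^ 2 <= J ^ 2)%N by rewrite leq_exp2r// ltnW.
  rewrite -[i%:Z ^+ 2]/((i ^ 2)%N%:Z); move: (i ^ 2)%N (J ^ 2)%N xD; clear => y z; lia.
move=> K DK.
have K2 rho : 2 * K%:Z * (B ^ rho)%N%:Z != 0.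
  by rewrite !mulf_neq0//; [rewrite -lt0n (leq_trans _ DK)|rewrite -lt0n expn_gt0 prime_gt0].
have /choice[Eg hEg] : forall rho, exists E : set R, [/\ measurable E, (mu E <= d%:E)%E &
      forall t, circ t -> ~ E t -> `|ev g ((2 * K%:Z * (B ^ rho)%N%:Z)%:~R * t) - 1| <= d].
  by move=> rho; apply: hg; exact: K2.
pose Q := levQ D (deg g) B K m; have hQ t : 2 <= ev Q t by exact: ev_levQ.
pose E1 := circ `&` [set t | A <= ev Q t].
pose E2 := \big[setU/set0]_(i < D.*2.+1) Eg i.
have mE1 : measurable E1 by apply: measurableI; [exact: measurable_circ|exact: measurable_ev_ge].
have mE2 : measurable E2 by apply: bigsetU_measurable => i _; have [] := hEg i.
exists (levW D (deg g) B K m), (levG D (deg g) B K m), Q, (E1 `|` E2); split.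
- split; first exact: measurableU.
  rewrite (le_trans (measureU2 _ _ _))//.
  have h1 : (mu E1 <= (e / 2)%:E)%E.
    rewrite (le_trans (markov_ev _ A0))//.
      by move=> t; rewrite (le_trans _ (hQ t)).
    rewrite lee_fin ler_pdivrMr//.
    rewrite (@le_trans _ _ (pi *+ 2 * 802))//; first by rewrite ler_wpM2l ?ct_levQ// ltW.
    rewrite /A; move: (pi *+ 2 * 802) => P.
    have -> : e / 2 * (1 + P * 2 / e) = e / 2 + P by field; rewrite gt_eqF.
    by rewrite lerDr divr_ge0// ltW.
  have h2 : (mu E2 <= (e / 2)%:E)%E.
    rewrite (le_trans (Boole_inequality _ _))//; first by move=> i _; have [] := hEg i.
    rewrite (@le_trans _ _ (\sum_(i < D.*2.+1) d%:E)%E)//.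
      by apply: lee_sum => i _; have [] := hEg i.
    rewrite sumEFin lee_fin sumr_const card_ord -[leLHS]mulr_natl -dE lerDr.
    exact: mulr_ge0 (mulr_ge0 nu0 (ltW d0)) (ltW A0).
  by rewrite (le_trans (leeD h1 h2))// -EFinD lee_fin -splitr.
- by split; [exact: gap_levG|exact: gap_levQ].
- by split=> [t|]; [exact: ev_levG|exact: ct_levG].
- by split=> [t|]; [exact: ev_levQ|exact: ct_levQ].
move=> r rD rnu.
have [|a [b ab]] := @level_sums D (deg g) B K pB dgB DK m d g r A (ltW d0) rD.
  by move=> x xg; split; [exact: g0|exact: mem_deg].
exists a, b => t ct Et /=.
have [||h1 h2] := ab t.
- move=> rho rhoD; have [_ _] := hEg rho; apply=> // Er; apply: Et; right.
  rewrite /E2 -(bigcup_mkord _ Eg); exists rho => //=.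
  by rewrite ltnS -mul2n.
- by rewrite leNgt; apply/negP => hA; apply: Et; left; split=> //=; exact: ltW.
have k1 : nrm r * d * A <= nu * d * A by rewrite !ler_wpM2r// ltW.
have k2 : nu * d * A <= e / 2 by rewrite -dE lerDl mulr_ge0// ltW.
have k3 : 8^-1 / 2 ^+ m * nrm r * nrm g <= e / 2.
  rewrite -mulrA (@le_trans _ _ (e / 2 / (nu * nrm g + 1) * (nu * nrm g + 1)))//; last first.
    by rewrite divfK// gt_eqF.
  rewrite ler_pM// ?mulr_ge0// ?nrm_ge0 ?divr_ge0 ?exprn_ge0//.
    rewrite (le_trans _ hm)// exprVn -[leRHS]mul1r ler_wpM2r ?invr_ge0 ?exprn_ge0//; lra.
  by rewrite (@le_trans _ _ (nu * nrm g))// ?ler_wpM2r// lerDl.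
split=> [n|]; last by rewrite (le_trans h2)// (le_trans k1)// (le_trans k2)//; lra.
by rewrite (le_trans (h1 n))// lerD2l; lra.
Qed.

End Level.

(** * Stages: iterating levels until the residual is small in measure *)

Section Stage.
Context {R : realType}.
Local Notation tp := (seq (R * R * int)).
Local Notation mu := (@lebesgue_measure R).

Definition osc (r : nat -> int) (a b : nat -> R) (t : R) (k : nat) : R :=
  a k * cos ((k%:Z ^+ 2 + r k)%:~R * t) + b k * sin ((k%:Z ^+ 2 + r k)%:~R * t).

(** The value [x0] fills the gap between the end m of what is already built and the start K of the
    new window. *)
Definition glue T (m K : nat) (x : nat -> T) (x0 : T) (y : nat -> T) (k : nat) :=
  if (k < m)%N then x k else if (k < K)%N then x0 else y (k - K)%N.

Lemma osc_glue0 (B m K n : nat) (r r' : nat -> int) a a' b b' (t : R) : (n <= m)%N ->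
  \sum_(B <= k < n) osc (glue m K r 0 r') (glue m K a 0 a') (glue m K b 0 b') t k =
  \sum_(B <= k < n) osc r a b t k.
Proof.
by move=> nm; apply: eq_big_nat => k /andP[_ kn]; rewrite /osc /glue (leq_trans kn nm).
Qed.

Lemma osc_glue (B m K n : nat) (r r' : nat -> int) a a' b b' (t : R) :
  (B <= m)%N -> (m <= K)%N -> (m <= n)%N ->
  \sum_(B <= k < n) osc (glue m K r 0 r') (glue m K a 0 a') (glue m K b 0 b') t k =
  \sum_(B <= k < m) osc r a b t k +
  \sum_(0 <= i < n - K) (a' i * cos (((K%:Z + i%:Z) ^+ 2 + r' i)%:~R * t) +
                         b' i * sin (((K%:Z + i%:Z) ^+ 2 + r' i)%:~R * t)).
Proof.
move=> Bm mK mn; rewrite (big_cat_nat Bm mn) /= osc_glue0//; congr (_ + _).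
have z0 p : (p <= K)%N -> \sum_(m <= k < p) osc (glue m K r 0 r') (glue m K a 0 a') (glue m K b 0 b') t k = 0.
  move=> pK; rewrite big_nat big1// => k /andP[mk kp].
  by rewrite /osc /glue ltnNge mk /= (leq_trans kp pK) !mul0r addr0.
have [nK|Kn] := leqP n K.
  by rewrite z0//; move: nK; rewrite -subn_eq0 => /eqP ->; rewrite big_geq.
rewrite (big_cat_nat mK (ltnW Kn)) /= z0// add0r -{1}[K]add0n big_addn.
apply: eq_big_nat => i _; rewrite /osc /glue !ltnNge leq_addl (leq_trans mK (leq_addl i K)) /=.
by rewrite addnK PoszD [i%:Z + _]addrC.
Qed.

Lemma ct_ge0 (p : tp) : (forall t, 0 <= ev p t) -> 0 <= ct p.
Proof.
move=> p0; have := integral_ev p.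
have : (0 <= \int[mu]_(t in `[0%R, (pi *+ 2)%R]) (ev p t)%:E)%E.
  by apply: integral_ge0 => t _; rewrite lee_fin.
by move=> /[swap] ->; rewrite lee_fin pmulr_rge0// pmulrn_lgt0// pi_gt0.
Qed.

Context (w : nat -> R) (w_infty : forall A : R, exists N, forall k, (N <= k)%N -> A <= w k).
Context (d s B : nat) (B_gt0 : (0 < B)%N).

(** The bound |r k| < k puts k ^ 2 + r k strictly between k ^ 2 - k and k ^ 2 + k, so the
    frequencies are positive and increasing. The factor s + 1, growing with the stage, gives
    o(w). *)
Definition small_shift (r : nat -> int) (B' : nat) := forall k, (B <= k < B')%N ->
  s.+1%:R * `|(r k)%:~R| <= `|w k| /\ (`|r k| < k)%N.

Context (gam c : R) (gam_gt0 : 0 < gam) (gam_lt1 : gam < 1) (c_gt0 : 0 < c).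
Context (level : level_property gam c).

(* After I levels the part of f still to be represented is f * rho. *)
Lemma stage_levels I (e : R) : 0 < e ->
  exists (B' : nat) (r : nat -> int) (rho G Y : tp) (E : set R),
  [/\ (B + I <= B')%N /\ small_shift r B',
      measurable E /\ (mu E <= e%:E)%E,
      (forall t, 0 <= ev G t /\ `|ev rho t| <= ev G t ^+ 2) /\ ct G <= gam ^+ I,
      (forall t, 0 <= ev Y t) /\ ct Y <= c / (1 - gam) * (1 - gam ^+ I) &
  forall f : tp, (deg f <= d)%N -> nrm f <= d%:R ->
  exists a b : nat -> R, forall t, circ t -> ~ E t ->
    `|\sum_(B <= k < B') osc r a b t k - (ev f t - ev f t * ev rho t)| <= e /\
    forall n, (n <= B')%N ->
      `|\sum_(B <= k < n) osc r a b t k| <= `|ev f t| * (1 + ev Y t ^+ 2) + e].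
Proof.
elim: I e => [|I ih] e e0.
  exists B, (fun=> 0), tone, tone, [::], set0; split.
  - by rewrite addn0; split=> // k; case: ltngtP.
  - by rewrite measure0 lee_fin ltW.
  - by split=> [t|]; rewrite ?ev_one ?ct_one ?expr1n ?normr1 ?expr0.
  - by split=> [t|]; rewrite /ev /ct ?big_nil// expr0 subrr mulr0.
  move=> f _ _; exists (fun=> 0), (fun=> 0) => t _ _; split.
    by rewrite big_geq// ev_one mulr1 subrr subr0 normr0 ltW.
  move=> n nB; rewrite big_geq// normr0 addr_ge0 ?(ltW e0)// mulr_ge0//.
  by rewrite addr_ge0// sqr_ge0.
have e20 : 0 < e / 2 by rewrite divr_gt0.
have [B1 [r1 [rho [G [Y [E1 [[BIB1 hr1] [mE1 muE1] [hG ctG] [Y0 ctY] h1]]]]]]] := ih _ e20.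
have BB1 : (B <= B1)%N := leq_trans (leq_addr _ _) BIB1.
have nu0 : 0 <= d%:R * nrm rho by rewrite mulr_ge0// nrm_ge0.
have [J [C [rr [rrC hlev]]]] := level (d + deg rho)%N nu0 e20.
have [N hN] := w_infty (s.+1%:R * C%:R).
(* N lets w dominate (s + 1) C, C < K gives |r k| < k, and deg G < K separates the new frequencies
   from those of G. *)
have [K [DK B1K' NK CK GK]] : exists K, [/\ d + deg rho < K, B1 < K, N <= K, C < K & deg G < K]%N.
  exists (d + deg rho + B1 + N + C + deg G).+1.
  by move: (d + deg rho)%N (deg G) => x y; clear; split; lia.
have B1K := ltnW B1K'.
have [W [G' [Q [E2 [[mE2 muE2] [gG gQ] [hG' ctG'] [hQ ctQ] h2]]]]] := hlev K DK.
have ctG0 : 0 <= ct G by apply: ct_ge0 => t; have [] := hG t.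
have gapG p : gap K p -> ct (tmul G p) = ct G * ct p.
  move=> gp; apply: ct_mul_gap => y /gp[|h]; [by left|right].
  exact: leq_trans GK h.
exists (K + J)%N, (glue B1 K r1 0 rr), (tmul rho (tone ++ W)), (tmul G G'), (Y ++ tmul G Q), (E1 `|` E2).
split.
- split; first by rewrite addnS (leq_ltn_trans BIB1)// (leq_trans B1K')// leq_addr.
  move=> k /andP[Bk kK]; rewrite /glue; case: ltnP => [kB1|B1k]; first by apply: hr1; rewrite Bk.
  case: ltnP => Kk; first by rewrite normr0 mulr0 normr_ge0 absz0 (leq_trans B_gt0).
  have hC : (`|rr (k - K)| <= C)%N by apply: rrC; rewrite ltn_subLR.
  split; last exact: leq_ltn_trans hC (leq_trans CK Kk).
  have wk : s.+1%:R * C%:R <= w k by apply: hN; exact: leq_trans NK Kk.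
  rewrite (le_trans _ (ler_norm _))// (le_trans _ wk)// ler_wpM2l// -intr_norm -abszE -pmulrn ler_nat//.
- split; first exact: measurableU.
  rewrite (le_trans (measureU2 _ _ _))// (le_trans (leeD muE1 muE2))//.
  by rewrite -EFinD lee_fin -splitr.
- split=> [t|].
    have [g0 g1] := hG t; have [g0' g1'] := hG' t.
    rewrite !ev_mul ev_cat ev_one; split; first exact: mulr_ge0.
    by rewrite normrM exprMn ler_pM.
  rewrite gapG// exprSr ler_pM//.
  by apply: ct_ge0 => t; have [] := hG' t.
- split=> [t|].
    by rewrite ev_cat ev_mul addr_ge0// mulr_ge0//; [have [] := hG t|rewrite (le_trans _ (hQ t))].
  (* The means of the successive terms G * Q form a geometric series, so the mean of Y is bounded
     independently of the number of levels. *)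
  have hq : ct G * ct Q <= gam ^+ I * c.
    by rewrite ler_pM//; apply: ct_ge0 => t; rewrite (le_trans _ (hQ t)).
  rewrite ct_cat gapG// exprSr; rewrite (le_trans (lerD ctY hq))// le_eqVlt; apply/orP; left; apply/eqP.
  by field; rewrite subr_eq0 gt_eqF.
move=> f fd nf.
have [a1 [b1 hab1]] := h1 f fd nf.
(* Applied to - f * rho, the level adds about - W * f * rho, which turns the residual f * rho into f
   * rho * (1 + W). *)
have [||a2 [b2 hab2]] := h2 (tscale (-1) (tmul f rho)).
- by rewrite deg_scale (leq_trans (deg_mul _ _))// leq_add2r.
- by rewrite nrm_scale nrm_mul normrN1 mul1r ler_wpM2r ?nrm_ge0.
exists (glue B1 K a1 0 a2), (glue B1 K b1 0 b2) => t ct Et.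
have [hS1 hS2] : _ /\ _ := hab1 t ct (fun h => Et (or_introl h)).
have [hU1 hU2] := hab2 t ct (fun h => Et (or_intror h)).
move: hU1 hU2; rewrite ev_scale ev_mul mulN1r normrN => hU1 hU2.
rewrite ev_cat !ev_mul ev_cat ev_one.
have [g0 g1] := hG t; have Qt := le_trans (ler0n _ 2) (hQ t); have Yt := Y0 t.
split.
  rewrite osc_glue//; last by rewrite (leq_trans B1K)// leq_addr.
  rewrite addKn.
  move: hS1 hU2; move: (\sum_(_ <= _ < _) _) (\sum_(_ <= _ < _) _) => x y.
  by rewrite !ler_norml; move: (ev f t) (ev rho t) (ev W t) => F P V; lra.
move=> n nB.
have [nB1|/ltnW B1n] := leqP n B1.
  rewrite osc_glue0// (le_trans (hS2 n nB1))// lerD//; last by lra.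
  by rewrite ler_wpM2l// lerD2l ler_sqr ?nnegrE ?lerDl ?addr_ge0 ?mulr_ge0.
rewrite osc_glue//.
have hU := hU1 (n - K)%N.
(* The bounds of the levels are not added up: the sum before this level is close to f * (1 - rho),
   at most |f| (1 + |rho|), and the -1 in |f rho| (Q ^ 2 - 1) absorbs |rho|. *)
have hf : `|ev f t - ev f t * ev rho t| <= `|ev f t| * (1 + `|ev rho t|).
  by rewrite mulrDr mulr1 -normrM ler_normB.
have hy : `|ev rho t| * ev Q t ^+ 2 <= (ev Y t + ev G t * ev Q t) ^+ 2.
  rewrite (@le_trans _ _ ((ev G t * ev Q t) ^+ 2))//.
    by rewrite exprMn ler_wpM2r// sqr_ge0.
  by rewrite ler_sqr ?nnegrE ?lerDr ?addr_ge0 ?mulr_ge0.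
have hfy := ler_wpM2l (normr_ge0 (ev f t)) hy.
move: hU hf hfy hS1; rewrite normrM.
move: (\sum_(_ <= _ < _) _) (\sum_(_ <= _ < _) _) => x y.
move: (ev f t - _) => z hU hf hfy hS1.
rewrite (le_trans (ler_normD _ _))//.
have : `|x| <= `|z| + e / 2.
  by rewrite -[x](subrK z) (le_trans (ler_normD _ _))// addrC lerD2l.
move: hU hf hfy; move: `|x| `|y| `|z| `|ev f t| `|ev rho t| => p q u F P.
by move=> *; lra.
Qed.

(** Where G < l <= 1, the residual is at most d * G ^ 2 <= d * l <= e / 2; the set where G >= l is
    small because the mean of G is at most gam ^ I. *)
Lemma stage (e : R) : 0 < e ->
  exists (B' : nat) (r : nat -> int) (Y : tp) (E : set R),
  [/\ (B < B')%N /\ small_shift r B',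
      measurable E /\ (mu E <= e%:E)%E,
      (forall t, 0 <= ev Y t) /\ ct Y <= c / (1 - gam) &
  forall f : tp, (deg f <= d)%N -> nrm f <= d%:R ->
  exists a b : nat -> R, forall t, circ t -> ~ E t ->
    `|\sum_(B <= k < B') osc r a b t k - ev f t| <= e /\
    forall n, (n <= B')%N ->
      `|\sum_(B <= k < n) osc r a b t k| <= `|ev f t| * (1 + ev Y t ^+ 2) + e].
Proof.
move=> e0; have e20 : 0 < e / 2 by rewrite divr_gt0.
have pi0 : 0 < pi *+ 2 :> R by rewrite pmulrn_lgt0// pi_gt0.
have D0 : 0 <= d%:R :> R by [].
have T0 : 0 < 2 * d%:R + 2 + e by lra.
pose l := e / (2 * d%:R + 2 + e); have l0 : 0 < l by rewrite divr_gt0.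
have l1 : l <= 1 by rewrite ler_pdivrMr//; lra.
have dl : d%:R * l <= e / 2.
  by rewrite /l mulrA ler_pdivrMr//; move: d%:R D0 => x D0; nra.
have [I0 hI] := @pow_small R gam (e / 2 * l / (pi *+ 2)) ltac:(by rewrite ltW)
  ltac:(by rewrite divr_gt0// mulr_gt0).
(* At least one level is used, which ensures B < B'. *)
have [B' [r [rho [G [Y [E [hB [mE muE] [hG ctG] [Y0 ctY] h]]]]]]] := stage_levels I0.+1 e20.
pose E1 := circ `&` [set t | l <= ev G t].
exists B', r, Y, (E `|` E1); split=> //.
- by case: hB => hB ?; split=> //; rewrite (leq_trans _ hB)// addnS ltnS leq_addr.
- split.
    apply: measurableU => //.
    by apply: measurableI; [exact: measurable_circ|exact: measurable_ev_ge].
  rewrite (le_trans (measureU2 _ _ _))//.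
    by apply: measurableI; [exact: measurable_circ|exact: measurable_ev_ge].
  have h1 : (mu E1 <= (e / 2)%:E)%E.
    rewrite (le_trans (markov_ev _ l0))//; first by move=> t; have [] := hG t.
    rewrite lee_fin ler_pdivrMr// mulrC -ler_pdivlMr//.
    by rewrite (le_trans ctG)// (le_trans _ hI)// exprS ler_piMl ?exprn_ge0// ltW.
  by rewrite (le_trans (leeD muE h1))// -EFinD lee_fin -splitr.
- split=> //; rewrite (le_trans ctY)// ler_piMr//.
    by rewrite divr_ge0 ?ltW// subr_gt0.
  by rewrite gerBl exprn_ge0// ltW.
move=> f fd nf; have [a [b hab]] := h f fd nf.
exists a, b => t ct Et.
have [h1 h2] := hab t ct (fun x => Et (or_introl x)).
split; last by move=> n /h2/le_trans; apply; rewrite lerD2l; lra.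
have Gl : ev G t < l.
  by rewrite ltNge; apply/negP => lG; apply: Et; right.
have [g0 g1] := hG t.
have : `|ev f t * ev rho t| <= e / 2.
  rewrite normrM (le_trans _ dl)// ler_pM//; first exact: le_trans (ev_le_nrm _ _) nf.
  by rewrite (le_trans g1)//; nra.
move: h1; rewrite !ler_norml; move: (\sum_(_ <= _ < _) _) (ev f t) (_ * ev rho t) => x y z.
by move=> *; lra.
Qed.

End Stage.

(** * Measurable functions are limits in measure of polynomials *)

Section Density.
Context {R : realType}.
Local Notation tp := (seq (R * R * int)).
Local Notation mu := (@lebesgue_measure R).

Lemma shrink (F : nat -> set R) (e : R) : 0 < e -> (forall i, measurable (F i)) ->
  mu.-negligible (circ `\` \bigcup_i F i) ->
  exists n, measurable (circ `\` \bigcup_(i < n) F i) /\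
            (mu (circ `\` \bigcup_(i < n) F i) <= e%:E)%E.
Proof.
move=> e0 mF nF; pose G n := circ `\` \bigcup_(i < n) F i.
have mG n : measurable (G n).
  apply: measurableD; first exact: measurable_circ.
  by rewrite bigcup_mkord; apply: bigsetU_measurable => i _; exact: mF.
have capG : \bigcap_n G n = circ `\` \bigcup_i F i.
  apply/seteqP; split=> t /=.
    move=> h; split; first by have [] := h 0%N I.
    by move=> [i _ Fi]; have [_] := h i.+1 I; apply; exists i => //=.
  by move=> [ct Ft] n _; split=> // -[i _ Fi]; apply: Ft; exists i.
have mcap : measurable (\bigcap_n G n) by exact: bigcapT_measurable.
have : (mu \o G) x @[x --> \oo] --> mu (\bigcap_n G n).
  apply: nonincreasing_cvg_mu => //.
    rewrite (@le_lt_trans _ _ (mu circ))//; last by rewrite mu_circ ltry.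
    by apply: le_measure; rewrite ?inE//; [exact: mG|exact: measurable_circ|move=> t []].
  move=> m n mn; apply/subsetPset => t [ct Ft]; split=> // -[i /= im Fi].
  by apply: Ft; exists i => //=; exact: leq_trans mn.
have -> : mu (\bigcap_n G n) = 0 by apply: measure_negligible => //; rewrite capG.
move=> /(_ [set y | (y < e%:E)%E]) []; first by apply: open_ereal_lt'; rewrite lte_fin.
move=> n _ /(_ n (leqnn n)) /= h; exists n; split; first exact: mG.
exact: ltW.
Qed.

Definition approx (f : R -> R) := forall e : R, 0 < e -> exists (p : tp) (E : set R),
  [/\ measurable E, (mu E <= e%:E)%E & forall t, circ t -> ~ E t -> `|f t - ev p t| <= e].

Lemma approx_ev p : approx (ev p).
Proof.
move=> e e0; exists p, set0; split=> [//||t _ _]; first by rewrite measure0 lee_fin ltW.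
by rewrite subrr normr0 ltW.
Qed.

Lemma approx_lim (f : R -> R) :
  (forall e : R, 0 < e -> exists (g : R -> R) (E : set R), approx g /\
    [/\ measurable E, (mu E <= e%:E)%E & forall t, circ t -> ~ E t -> `|f t - g t| <= e]) ->
  approx f.
Proof.
move=> h e e0; have e20 : 0 < e / 2 by rewrite divr_gt0.
have [g [E [/(_ _ e20)[p [E' [mE' uE' hp]]] [mE uE hg]]]] := h _ e20.
exists p, (E `|` E'); split; first exact: measurableU.
  by rewrite (le_trans (measureU2 _ _ _))// (le_trans (leeD uE uE'))// -EFinD lee_fin -splitr.
move=> t ct Et; rewrite -(subrK (g t) (f t)) -addrA (le_trans (ler_normD _ _))//.
rewrite [leRHS]splitr lerD//; first by apply: hg => // ?; apply: Et; left.
by apply: hp => // ?; apply: Et; right.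
Qed.

Lemma approx_add f g : approx f -> approx g -> approx (fun t => f t + g t).
Proof.
move=> hf hg e e0; have e20 : 0 < e / 2 by rewrite divr_gt0.
have [p [E [mE uE hp]]] := hf _ e20; have [q [E' [mE' uE' hq]]] := hg _ e20.
exists (p ++ q), (E `|` E'); split; first exact: measurableU.
  by rewrite (le_trans (measureU2 _ _ _))// (le_trans (leeD uE uE'))// -EFinD lee_fin -splitr.
move=> t ct Et; rewrite ev_cat opprD addrACA (le_trans (ler_normD _ _))//.
rewrite [leRHS]splitr lerD//; first by apply: hp => // ?; apply: Et; left.
by apply: hq => // ?; apply: Et; right.
Qed.

(** The approximation q is chosen after p, with a tolerance depending on [nrm p], since f itself
    need not be bounded. *)
Lemma approx_mul f g : (forall t, `|g t| <= 1) -> approx f -> approx g ->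
  approx (fun t => f t * g t).
Proof.
move=> g1 hf hg e e0; have e20 : 0 < e / 2 by rewrite divr_gt0.
have [p [E [mE uE hp]]] := hf _ e20; have n0 := nrm_ge0 p.
have T0 : 0 < nrm p + 1 by rewrite ltr_wpDl.
have d0 : 0 < e / 2 / (nrm p + 1) by rewrite divr_gt0.
have [q [E' [mE' uE' hq]]] := hg _ d0.
have de : e / 2 / (nrm p + 1) <= e / 2 by rewrite ler_pdivrMr// ler_peMr ?(ltW e20)// lerDr.
exists (tmul p q), (E `|` E'); split; first exact: measurableU.
  rewrite (le_trans (measureU2 _ _ _))// (le_trans (leeD uE uE'))// -EFinD lee_fin.
  by rewrite [leRHS]splitr lerD2l.
move=> t ct Et; rewrite ev_mul.
have -> : f t * g t - ev p t * ev q t = (f t - ev p t) * g t + ev p t * (g t - ev q t) by ring.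
rewrite (le_trans (ler_normD _ _))// !normrM [leRHS]splitr lerD//.
  rewrite -[leRHS]mulr1 ler_pM//.
  by apply: hp => // ?; apply: Et; left.
rewrite (@le_trans _ _ ((nrm p + 1) * (e / 2 / (nrm p + 1))))//; last first.
  by rewrite mulrC divfK// gt_eqF.
rewrite ler_pM// ?(le_trans (ev_le_nrm p t)) ?lerDl//.
by apply: hq => // ?; apply: Et; right.
Qed.

Lemma approx_const (c : R) : approx (fun=> c).
Proof.
rewrite (_ : (fun=> c) = ev (tscale c tone)); first exact: approx_ev.
by apply/funext => t; rewrite ev_scale ev_one mulr1.
Qed.

Lemma bernoulli_ge (x : R) n : -1 <= x -> 1 + n%:R * x <= (1 + x) ^+ n.
Proof.
move=> x1; elim: n => [|n ih]; first by rewrite mul0r addr0.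
rewrite exprS (@le_trans _ _ ((1 + x) * (1 + n%:R * x)))//; last first.
  by rewrite ler_wpM2l//; lra.
have -> : (1 + x) * (1 + n%:R * x) = 1 + n.+1%:R * x + n%:R * x ^+ 2 by rewrite -natr1; ring.
by rewrite lerDl mulr_ge0// sqr_ge0.
Qed.

(* The polynomials (1 - x ^ n) ^ (2 ^ n) tend to 1 on [0, 1/2[ and to 0 on ]1/2, 1]. *)
Lemma step_poly (h e : R) : 0 < h <= 1 -> 0 < e -> exists n, forall x : R, 0 <= x <= 1 ->
  (2 * x <= 1 - h -> `|1 - (1 - x ^+ n) ^+ (2 ^ n)| <= e) /\
  (1 + h <= 2 * x -> `|(1 - x ^+ n) ^+ (2 ^ n)| <= e).
Proof.
move=> /andP[h0 h1] e0.
have [|m hm] := @pow_small R (1 - h) e _ e0; first by apply/andP; split; lra.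
have [k hk] : exists k, e^-1 <= k%:R * h.
  exists (Num.truncn (e^-1 / h)).+1.
  by rewrite -ler_pdivrMr// ltW// truncnS_gt.
exists (maxn m k) => x /andP[x0 x1]; set n := maxn m k.
have y0 : 0 <= x ^+ n by exact: exprn_ge0.
have y1 : x ^+ n <= 1 by exact: exprn_ile1.
have z0 : 0 <= 1 - x ^+ n by rewrite subr_ge0.
have ny : (2 ^ n)%:R * x ^+ n = (2 * x) ^+ n by rewrite natrX exprMn.
split=> hx.
  have le1 : (1 - x ^+ n) ^+ (2 ^ n) <= 1 by apply: exprn_ile1 => //; lra.
  rewrite ger0_norm ?subr_ge0//.
  have b : 1 - (2 * x) ^+ n <= (1 - x ^+ n) ^+ (2 ^ n).
    by rewrite -ny -mulrN; apply: bernoulli_ge; lra.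
  have : (2 * x) ^+ n <= e; last by lra.
  rewrite (@le_trans _ _ ((1 - h) ^+ n))//; first by rewrite lerXn2r ?nnegrE; lra.
  by rewrite (le_trans _ hm)// ler_wiXn2l ?leq_maxl//; lra.
rewrite ger0_norm ?exprn_ge0//.
(* Bernoulli bounds (1 + x ^ n) ^ (2 ^ n) from below; its product with (1 - x ^ n) ^ (2 ^ n) is at
   most 1. *)
have b : 1 + (2 * x) ^+ n <= (1 + x ^+ n) ^+ (2 ^ n).
  by rewrite -ny; apply: bernoulli_ge; lra.
have c1 : e^-1 <= (1 + x ^+ n) ^+ (2 ^ n).
  rewrite (le_trans _ b)// (@le_trans _ _ ((1 + h) ^+ n))//; last first.
    by rewrite ler_wpDl// lerXn2r ?nnegrE; lra.
  rewrite (@le_trans _ _ (1 + n%:R * h))//; last by apply: bernoulli_ge; lra.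
  rewrite ler_wpDl// (le_trans hk)// ler_wpM2r ?ler_nat ?leq_maxr// ltW//.
have c2 : (1 - x ^+ n) ^+ (2 ^ n) * (1 + x ^+ n) ^+ (2 ^ n) <= 1.
  rewrite -exprMn; apply: exprn_ile1; first by rewrite mulr_ge0//; lra.
  by have := sqr_ge0 (x ^+ n); lra.
have p0 := exprn_ge0 (2 ^ n) z0.
by rewrite -[leRHS]mul1r -ler_pdivrMr// (le_trans _ c2)// ler_wpM2l.
Qed.

Definition tpow (p : tp) n : tp := iter n (tmul p) tone.

Lemma ev_pow p n t : ev (tpow p n) t = ev p t ^+ n.
Proof. by elim: n => [|n ih]; rewrite ?ev_one ?expr0//= ev_mul ih exprS. Qed.

Lemma negligible_set1 (x : R) : mu.-negligible [set x].
Proof. by exists [set x]; split => //; exact: lebesgue_measure_set1. Qed.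

Lemma approx_ray (x : R) : approx (fun t => \1_`]x, +oo[%classic t).
Proof.
have pi0 := pi_gt0 R; have [x0|x0] := ltP x 0.
  apply: approx_lim => e e0; exists (fun=> 1), set0; split; first exact: approx_const.
  split=> // [|t]; first by rewrite measure0 lee_fin ltW.
  rewrite /circ /= in_itv /= => /andP[t0 _] _.
  by rewrite indicE mem_set ?subrr ?normr0 ?(ltW e0)//= in_itv /= andbT (lt_le_trans x0).
have [x1|x1] := leP (pi *+ 2) x.
  apply: approx_lim => e e0; exists (fun=> 0), set0; split; first exact: approx_const.
  split=> // [|t]; first by rewrite measure0 lee_fin ltW.
  rewrite /circ /= in_itv /= => /andP[_ t1] _.
  rewrite indicE memNset ?subrr ?normr0 ?(ltW e0)//= in_itv /= andbT.
  by apply/negP; rewrite -leNgt (le_trans t1).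
(* This is cos (x / 2) - cos (t - x / 2): negative on ]0, x[ and positive on ]x, 2 pi[. *)
pose phi : tp := [:: (cos (x / 2), 0, 0); (-1, - (x / 2), 1)].
have phiE t : ev phi t = 2 * sin ((t - x) / 2) * sin (t / 2).
  rewrite /ev big_cons big_seq1 /= mul0r addr0 cos0 mulr1 mul1r.
  have -> : t - x / 2 = t / 2 + (t - x) / 2 by field.
  have -> : x / 2 = t / 2 - (t - x) / 2 by field.
  by rewrite cosB cosD; ring.
have phi2 t : -2 <= ev phi t <= 2.
  rewrite phiE; have := sin_le1 ((t - x) / 2); have := sin_geN1 ((t - x) / 2).
  have := sin_le1 (t / 2); have := sin_geN1 (t / 2).
  by move: (sin _) (sin _) => a b *; apply/andP; split; nra.
pose F i := [set t | i.+1%:R^-1 <= ev phi t] `|` [set t | i.+1%:R^-1 <= ev (tscale (-1) phi) t].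
move=> e e0.
have [||n [mE uE]] := @shrink F e e0.
- by move=> i; apply: measurableU; exact: measurable_ev_ge.
- apply: (@negligibleS _ _ _ mu ([set 0] `|` [set x] `|` [set pi *+ 2])); last first.
    by do 2?[apply: negligibleU]; exact: negligible_set1.
  move=> t [ct Ft]; apply: contrapT => h.
  have [t0 tx t2] : [/\ t != 0, t != x & t != pi *+ 2].
    by split; apply/eqP => tE; apply: h; rewrite tE; [left; left|left; right|right].
  move: ct; rewrite /circ /= in_itv /= => /andP[ct0 ct2].
  have {}t0 : 0 < t by rewrite lt_neqAle eq_sym t0.
  have {}t2 : t < pi *+ 2 by rewrite lt_neqAle t2.
  rewrite -[pi *+ 2]mulr_natl in x1 t2.
  have s0 : 0 < sin (t / 2) by apply: sin_gt0_pi; apply/andP; split; lra.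
  have s1 : sin ((t - x) / 2) != 0.
    have [tx'|tx'|tx'] := ltgtP t x; last by rewrite tx' eqxx in tx.
      have -> : (t - x) / 2 = - ((x - t) / 2) by field.
      by rewrite sinN oppr_eq0 gt_eqF// sin_gt0_pi//; apply/andP; split; lra.
    by rewrite gt_eqF// sin_gt0_pi//; apply/andP; split; lra.
  have p0 : 0 < `|ev phi t| by rewrite normr_gt0 phiE !mulf_neq0// gt_eqF.
  apply: Ft; exists (Num.truncn `|ev phi t|^-1) => //.
  have : (Num.truncn `|ev phi t|^-1).+1%:R^-1 <= `|ev phi t|.
    by rewrite invf_ple ?posrE// ltW// truncnS_gt.
  rewrite /F /= ev_scale mulN1r; case: (ger0P (ev phi t)) => _ hh; [by left|by right].
have [y [y0 y1 yi]] : exists y : R, [/\ 0 < y, y <= 1 & forall i, (i < n)%N -> y <= i.+1%:R^-1].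
  exists n.+1%:R^-1; split=> [||i im]; first by rewrite invr_gt0.
    by rewrite invf_le1// ler1n.
  by rewrite lef_pV2 ?posrE// ler_nat ltnW.
have [|k hk] := @step_poly (y / 2) e _ e0; first by apply/andP; split; lra.
(* u = 1 / 2 - phi / 4 has values in [0, 1] and is below 1 / 2 exactly where phi > 0, as [step_poly]
   requires. *)
pose u := tscale 2^-1 tone ++ tscale (- 4^-1) phi.
exists (tpow (tone ++ tscale (-1) (tpow u k)) (2 ^ k)), (circ `\` \bigcup_(i < n) F i).
split=> // t ct Et; rewrite ev_pow ev_cat ev_scale ev_one ev_pow mulN1r.
have uE' : ev u t = 2^-1 - ev phi t / 4 by rewrite ev_cat !ev_scale ev_one; ring.
have /andP[q1 q2] := phi2 t.
have [|h1 h2] := hk (ev u t); first by rewrite uE'; apply/andP; split; lra.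
have [i /= im Fi] : (\bigcup_(i < n) F i) t by apply: contrapT => h; apply: Et.
have ni := yi i im.
move: ct; rewrite /circ /= in_itv /= => /andP[ct0 ct2]; rewrite -mulr_natl in ct2.
have st : 0 <= sin (t / 2) by apply: sin_ge0_pi; apply/andP; split; lra.
case: Fi; rewrite /= ?ev_scale ?mulN1r => /(le_trans ni) Fi.
  rewrite indicE mem_set; first by apply: h1; rewrite uE'; lra.
  rewrite /= in_itv /= andbT ltNge; apply/negP => tx.
  have : sin ((t - x) / 2) <= 0.
    have -> : (t - x) / 2 = - ((x - t) / 2) by field.
    by rewrite sinN oppr_le0; apply: sin_ge0_pi; rewrite -mulr_natl in x1; apply/andP; split; lra.
  by move=> s1; rewrite phiE in Fi; nra.
rewrite indicE memNset; first by rewrite sub0r normrN; apply: h2; rewrite uE'; lra.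
rewrite /= in_itv /= andbT => tx.
have s1 : 0 <= sin ((t - x) / 2) by apply: sin_ge0_pi; apply/andP; split; lra.
by rewrite phiE in Fi; nra.
Qed.

Lemma indic_le1 (A : set R) t : `|\1_A t : R| <= 1.
Proof. by rewrite indicE; case: (_ \in _); rewrite ?normr1 ?normr0. Qed.

Lemma approx_indic (A : set R) : measurable A -> approx (fun t => \1_A t).
Proof.
pose S : set (set R) := [set A | measurable A /\ approx (fun t => \1_A t)].
suff : @measurable _ (measurableTypeR R) `<=` S by move=> h /h[].
have SC A' : S A' -> S (~` A').
  move=> [mA aA]; split; first exact: measurableC.
  rewrite (_ : (fun t => _) = (fun t => 1 + -1 * \1_A' t)).
    by apply: approx_add (approx_const _) (approx_mul (indic_le1 _) (approx_const _) aA).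
  apply/funext => t; rewrite !indicE in_setC mulN1r.
  by case: (t \in A'); rewrite ?subrr ?subr0.
have SI A' B' : S A' -> S B' -> S (A' `&` B').
  move=> [mA aA] [mB aB]; split; first exact: measurableI.
  rewrite (_ : (fun t => _) = (fun t => \1_A' t * \1_B' t)).
    exact: approx_mul (indic_le1 _) aA aB.
  by apply/funext => t; rewrite !indicE in_setI; case: (_ \in _); case: (_ \in _); rewrite ?mulr1 ?mulr0.
have S0 : S set0.
  split=> //; rewrite (_ : (fun t => _) = fun=> 0); first exact: approx_const.
  by apply/funext => t; rewrite indicE in_set0.
have SU A' B' : S A' -> S B' -> S (A' `|` B').
  by move=> sA sB; rewrite -[A' `|` B']setCK setCU; apply: (SC); apply: (SI); exact: SC.
rewrite RGenOInfty.measurableE; apply: smallest_sub; last first.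
  by move=> _ [x ->]; split; [exact: measurable_itv|exact: approx_ray].
split=> //; first by move=> A'; rewrite setTD; exact: SC.
move=> F SF; have mF i : measurable (F i) by have [] := SF i.
have mU : measurable (\bigcup_k F k) by exact: bigcupT_measurable.
split=> //; apply: approx_lim => e e0.
(* The complement of the union is adjoined to each set so that together they cover the circle. *)
have [||n [mE uE]] := @shrink (fun i => F i `|` ~` \bigcup_k F k) e e0.
- by move=> i; apply: measurableU => //; exact: measurableC.
- rewrite (_ : _ `\` _ = set0); first exact: negligible_set0.
  apply/seteqP; split=> // t [_]; apply; have [[k _ Fk]|nU] := pselect ((\bigcup_k F k) t).
    by exists k => //; left.
  by exists 0%N => //; right.
exists (fun t => \1_(\bigcup_(i < n) F i) t), (circ `\` \bigcup_(i < n) (F i `|` ~` \bigcup_k F k)).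
split.
  suff [] : S (\bigcup_(i < n) F i) by [].
  by rewrite bigcup_mkord; elim/big_ind: _ => // i _; exact: SF.
split=> // t ct Et.
have [i /= im Fi] : (\bigcup_(i < n) (F i `|` ~` \bigcup_k F k)) t.
  by apply: contrapT => h; apply: Et.
rewrite !indicE.
have [tn|tn] := pselect ((\bigcup_(i < n) F i) t).
  rewrite !mem_set ?subrr ?normr0 ?ltW//.
  by have [k _ Fk] := tn; exists k.
rewrite !memNset ?subrr ?normr0 ?ltW//.
by case: Fi => // Fi _; apply: tn; exists i.
Qed.

Lemma approx_sum (I : Type) (s : seq I) (f : I -> R -> R) :
  (forall i, approx (f i)) -> approx (fun t => \sum_(i <- s) f i t).
Proof.
move=> hf; elim: s => [|i s ih].
  rewrite (_ : (fun t => _) = fun=> 0); first exact: approx_const.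
  by apply/funext => t; rewrite big_nil.
rewrite (_ : (fun t => _) = fun t => f i t + \sum_(j <- s) f j t); first exact: approx_add.
by apply/funext => t; rewrite big_cons.
Qed.

Lemma count_below (y : R) n : 0 <= y ->
  (n%:R <= y -> \sum_(k <- iota 0 n) (k.+1%:R <= y)%R%:R = n%:R :> R) /\
  (y <= n%:R -> `|y - \sum_(k <- iota 0 n) (k.+1%:R <= y)%R%:R| <= 1 :> R).
Proof.
move=> y0; elim: n => [|n [ih1 ih2]].
  rewrite big_nil; split=> // yn; have -> : y = 0 by apply/eqP; rewrite eq_le yn.
  by rewrite subrr normr0.
rewrite -addn1 iotaD big_cat /= big_seq1 add0n addn1; split=> yn.
  rewrite ih1; last by rewrite (le_trans _ yn)// ler_nat.
  by rewrite yn natr1.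
have [nn|nn] := leP y n%:R.
  have -> : (n.+1%:R <= y) = false by apply/negbTE; rewrite -ltNge (le_lt_trans nn)// ltr_nat.
  by rewrite addr0; exact: ih2.
rewrite ih1; last exact: ltW.
rewrite -natr1 in yn *.
by case: (boolP (n%:R + 1 <= y)) => h /=; rewrite ler_norml; apply/andP; split; lra.
Qed.

(** Where |f| <= n, the value f + n is recovered within e by counting the multiples of e below it.
    The level sets are only Lebesgue measurable and are replaced by Borel sets up to null sets. *)
Lemma approx_measurable (f : R -> R) :
  measurable_fun (setT : set (lebesgueType R)) (fun t : lebesgueType R => f t) -> approx f.
Proof.
move=> mf.
have rep Y : measurable Y -> exists B : set R, [/\ measurable B, B `<=` f @^-1` Y &
    mu.-negligible (f @^-1` Y `\` B)].
  move=> mY; have : @measurable _ (lebesgueType R) (f @^-1` Y).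
    by rewrite -[X in measurable X]setTI; exact: mf.
  rewrite /lebesgueType g_sigma_completed_algebra_genE => -[B mB [N nN BN]].
  rewrite -BN; exists B; split=> //.
  by apply: negligibleS nN => t [[Bt|//] /(_ Bt)].
have aind (c1 : R) : approx (fun t => (c1 <= f t)%R%:R).
  have [B [mB BA [N [mN N0 hN]]]] := rep _ (measurable_itv `[c1, +oo[).
  apply: approx_lim => e e0; exists (fun t => \1_B t), N; split; first exact: approx_indic.
  split=> //; first by rewrite N0 lee_fin ltW.
  move=> t _ Nt; rewrite indicE; have [Bt|Bt] := pselect (B t).
    have := BA t Bt; rewrite /= in_itv /= andbT => ->.
    by rewrite mem_set// subrr normr0 ltW.
  rewrite memNset//; case: (boolP (c1 <= f t)) => [ct|_]; last by rewrite subrr normr0 ltW.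
  by exfalso; apply: Nt; apply: hN; split=> //=; rewrite in_itv /= ct.
have /choice[B hB] : forall i : nat, exists B : set R, [/\ measurable B,
    B `<=` f @^-1` [set` `[- i%:R, i%:R]] & mu.-negligible (f @^-1` [set` `[- i%:R, i%:R]] `\` B)].
  by move=> i; apply: rep.
apply: approx_lim => e e0.
have [||n [mE uE]] := @shrink B e e0.
- by move=> i; have [] := hB i.
- apply: (@negligibleS _ _ _ mu (\bigcup_i (f @^-1` [set` `[- i%:R, i%:R]] `\` B i))); last first.
    by apply: negligible_bigcup => i; have [] := hB i.
  move=> t [_ Bt]; exists (Num.truncn `|f t|).+1 => //; split; last by move=> h; apply: Bt; exists (Num.truncn `|f t|).+1.
  by rewrite /= in_itv /= -ler_norml ltW// truncnS_gt.
pose K := (Num.truncn (2 * n%:R / e)).+1.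
have hK : 2 * n%:R / e <= K%:R by rewrite ltW// truncnS_gt.
exists (fun t => - n%:R + \sum_(k <- iota 0 K) (e * (k.+1%:R * e - n%:R <= f t)%R%:R)), (circ `\` \bigcup_(i < n) B i).
split.
  apply: approx_add; first exact: approx_const.
  apply: approx_sum => k; apply: approx_mul; [|exact: approx_const|exact: aind].
  by move=> t; case: (_ - _ <= f t); rewrite ?normr1 ?normr0.
split=> // t ct Et.
have [i /= im Bi] : (\bigcup_(i < n) B i) t by apply: contrapT => h; apply: Et.
have [_ /(_ t Bi) /=] := hB i; rewrite in_itv /= => /andP[f1 f2] _.
have ni : i%:R <= n%:R :> R by rewrite ler_nat ltnW.
have y0 : 0 <= (f t + n%:R) / e by rewrite divr_ge0 ?(ltW e0)//; lra.
have [_ h2] := count_below K y0.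
have : (f t + n%:R) / e <= K%:R by rewrite (le_trans _ hK)// ler_wpM2r ?invr_ge0 ?(ltW e0)//; lra.
move=> /h2; rewrite -mulr_sumr.
rewrite (eq_bigr (fun k => (k.+1%:R * e - n%:R <= f t)%R%:R)); last first.
  by move=> k _; rewrite ler_pdivlMr// lerBlDr.
move: (\sum_(_ <- _) _) => S hS.
have -> : f t - (- n%:R + e * S) = e * ((f t + n%:R) / e - S) by field; rewrite gt_eqF.
by rewrite normrM (gtr0_norm e0) ler_piMr// ltW.
Qed.

End Density.

(** * Consecutive windows and the sequence of stages *)

Lemma ltn_homo_leq (b : nat -> nat) : (forall s, (b s < b s.+1)%N) ->
  forall i j, (i <= j)%N -> (b i <= b j)%N.
Proof.
move=> b_lt i j; elim: j => [|j ih]; first by rewrite leqn0 => /eqP ->.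
by rewrite leq_eqVlt ltnS => /orP[/eqP ->//|/ih/leq_trans]; apply; exact: ltnW.
Qed.

Lemma window (b : nat -> nat) k : (forall s, (b s < b s.+1)%N) -> (b 0 <= k)%N ->
  exists s, (b s <= k < b s.+1)%N.
Proof.
move=> b_lt b0k.
have kb s : (k < b s)%N -> exists s, (b s <= k < b s.+1)%N.
  elim: s => [|s ih]; first by rewrite ltnNge b0k.
  by case: (leqP (b s) k) => [bk kb|/ih//]; exists s; rewrite bk.
apply: (kb k.+1); have : forall s, (s <= b s)%N; last by apply.
by elim=> // s /leq_ltn_trans; apply.
Qed.

Lemma window_inj (b : nat -> nat) k s s' : (forall s, (b s < b s.+1)%N) ->
  (b s <= k < b s.+1)%N -> (b s' <= k < b s'.+1)%N -> s = s'.
Proof.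
move=> /ltn_homo_leq b_le /andP[s1 s2] /andP[s3 s4]; apply/eqP; rewrite eqn_leq.
by apply/andP; split; rewrite leqNgt; apply/negP => /b_le ss';
  [have := leq_trans s4 (leq_trans ss' s1)|have := leq_trans s2 (leq_trans ss' s3)]; rewrite ltnn.
Qed.

Section Stages.
Context {R : realType}.
Local Notation tp := (seq (R * R * int)).
Local Notation mu := (@lebesgue_measure R).
Context (w : nat -> R) (w_infty : forall A : R, exists N, forall k, (N <= k)%N -> A <= w k).

(** The index s sets both the size of the admissible polynomials and the tolerance 16 ^ -s. Shifts,
    majorant and exceptional set precede f, so one spectrum serves all functions. *)
Definition stage_property (C : R) (s B B' : nat) (r : nat -> int) (Y : tp) (E : set R) :=
  [/\ (B < B')%N /\ small_shift w s B r B',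
      measurable E /\ (mu E <= (16^-1 ^+ s)%:E)%E,
      (forall t, 0 <= ev Y t) /\ ct Y <= C &
  forall f : tp, (deg f <= s)%N -> nrm f <= s%:R ->
  exists a b : nat -> R, forall t, circ t -> ~ E t ->
    `|\sum_(B <= k < B') osc r a b t k - ev f t| <= 16^-1 ^+ s /\
    forall n, (n <= B')%N ->
      `|\sum_(B <= k < n) osc r a b t k| <= `|ev f t| * (1 + ev Y t ^+ 2) + 16^-1 ^+ s].

Lemma stages : exists (C : R) (Bs : nat -> nat) (r : nat -> int) (Y : nat -> tp) (E : nat -> set R),
  [/\ 0 < C, Bs 0%N = 1%N & forall s, stage_property C s (Bs s) (Bs s.+1) r (Y s) (E s)].
Proof.
have [gam [c [g0 g1 c0 lev]]] := @level R.
have /choice[F hF] : forall sB : nat * nat, exists x : nat * (nat -> int) * tp * set R,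
    (0 < sB.2)%N -> stage_property (c / (1 - gam)) sB.1 sB.2 x.1.1.1 x.1.1.2 x.1.2 x.2.
  move=> [s B] /=; have [->|B0] := posnP B; first by exists (0%N, fun=> 0, [::], set0).
  have e0 : 0 < 16^-1 ^+ s :> R by rewrite exprn_gt0.
  have [B' [r [Y [E h]]]] := stage w_infty s s B0 g0 g1 c0 lev e0.
  by exists (B', r, Y, E).
pose Bs := fix Bs s := if s is s'.+1 then (F (s', Bs s')).1.1.1 else 1%N.
have Bs0 s : (0 < Bs s)%N.
  by elim: s => // s ih; have [[+ _] _ _ _] := hF (s, Bs s) ih => /= /(leq_trans _); apply.
have hB s := hF (s, Bs s) (Bs0 s).
have Bs_lt s : (Bs s < Bs s.+1)%N by have [[]] := hB s.
have Bs_le : forall i j, (i <= j)%N -> (Bs i <= Bs j)%N.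
  exact: ltn_homo_leq.
have /choice[r hr] : forall k, exists x : int, forall s, (Bs s <= k < Bs s.+1)%N ->
    x = (F (s, Bs s)).1.1.2 k.
  move=> k; have [[s sk]|h] := pselect (exists s, Bs s <= k < Bs s.+1)%N; last first.
    by exists 0 => s sk; exfalso; apply: h; exists s.
  by exists ((F (s, Bs s)).1.1.2 k) => s' s'k; rewrite (window_inj Bs_lt sk s'k).
exists (c / (1 - gam)), Bs, r, (fun s => (F (s, Bs s)).1.2), (fun s => (F (s, Bs s)).2).
split=> // [|s]; first by rewrite divr_gt0// subr_gt0.
have [[h1 h2] h3 h4 h5] := hB s; split=> //.
  by split=> // k kB; rewrite (hr k s kB); exact: h2.
move=> f fd nf; have [a [b hab]] := h5 f fd nf; exists a, b => t tc Et.
have [h6 h7] := hab t tc Et.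
have oscE n : (n <= Bs s.+1)%N ->
    \sum_(Bs s <= k < n) osc r a b t k = \sum_(Bs s <= k < n) osc (F (s, Bs s)).1.1.2 a b t k.
  move=> nB; apply: eq_big_nat => k /andP[k1 k2].
  by rewrite /osc (hr k s)// k1 (leq_trans k2).
split; first by rewrite oscE.
by move=> n nB; rewrite oscE//; exact: h7.
Qed.

End Stages.

(** * Almost everywhere representation of a real function *)

Section Representation.
Context {R : realType}.
Local Notation tp := (seq (R * R * int)).
Local Notation mu := (@lebesgue_measure R).
Context (w : nat -> R) (C : R) (Bs : nat -> nat) (r : nat -> int) (Y : nat -> tp) (E : nat -> set R).
Context (C_gt0 : 0 < C) (Bs_start : Bs 0 = 1%N).
Context (stagesP : forall s, stage_property w C s (Bs s) (Bs s.+1) r (Y s) (E s)).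

Lemma Bs_lt s : (Bs s < Bs s.+1)%N.
Proof. by have [[]] := stagesP s. Qed.

Lemma Bs_le i j : (i <= j)%N -> (Bs i <= Bs j)%N.
Proof. by apply: ltn_homo_leq => s; exact: Bs_lt. Qed.

(** Sines become cosines of phase - pi / 2, so that the sum obtained so far is again a polynomial
    and can enter the next correction. *)
Definition oscl (a b : nat -> R) (m n : nat) : tp :=
  flatten [seq [:: (a k, 0, k%:Z ^+ 2 + r k); (b k, - (pi / 2), k%:Z ^+ 2 + r k)] | k <- index_iota m n].

Lemma ev_oscl a b m n t : ev (oscl a b m n) t = \sum_(m <= k < n) osc r a b t k.
Proof.
rewrite ev_flatten; apply: eq_bigr => k _.
by rewrite /ev big_cons big_seq1 /= addr0 /osc cosB cos_pihalf sin_pihalf mulr0 add0r mulr1.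
Qed.

Lemma mu_setU (A B : set R) (x y : R) : measurable A -> measurable B ->
  (mu A <= x%:E)%E -> (mu B <= y%:E)%E -> (mu (A `|` B) <= (x + y)%:E)%E.
Proof.
by move=> mA mB hA hB; rewrite (le_trans (measureU2 _ _ _))// EFinD leeD.
Qed.

Lemma borel_cantelli_geometric (F : nat -> set R) (c : R) : 0 <= c -> (forall l, measurable (F l)) ->
  (forall l, (mu (F l) <= (c / 2 ^+ l)%:E)%E) -> mu (lim_sup_set F) = 0.
Proof.
move=> c0 mF hF; apply: lim_sup_set_cvg0 => //.
have := @epsilon_trick R (fun=> 0%E) (2 * c) xpredT (fun=> lexx _) (mulr_ge0 (ler0n _ 2) c0).
rewrite [X in (_ <= X + _)%E -> _]eseries0//.
rewrite add0e => h; apply: (@le_lt_trans _ _ (2 * c)%:E); last exact: ltry.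
apply: le_trans h; apply: lee_nneseries => // l _; rewrite (le_trans (hF l))// add0e lee_fin.
by rewrite natrX exprS; rewrite (_ : c / _ = 2 * c / (2 * 2 ^+ l))//; field; rewrite expf_neq0.
Qed.

(** Degree and norm of the sum obtained so far are not controlled, so each correction waits for a
    stage large enough; windows skipped meanwhile get zero coefficients. At step l the correction
    has size of order 16 ^ -l and Y is below 2 ^ l, whence oscillations of order 4 ^ -l. *)
Lemma represent (f : R -> R) : approx f -> exists (a b : nat -> R) (N : set R),
  mu.-negligible N /\ forall t, circ t -> ~ N t ->
    (fun n => \sum_(1 <= k < n) osc r a b t k) @ \oo --> f t.
Proof.
move=> af; have h16 l : 0 < 16^-1 ^+ l :> R by rewrite exprn_gt0.
have /choice[pE hpE] : forall l, exists pE : tp * set R, [/\ measurable pE.2,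
    (mu pE.2 <= (16^-1 ^+ l)%:E)%E & forall t, circ t -> ~ pE.2 t -> `|f t - ev pE.1 t| <= 16^-1 ^+ l].
  by move=> l; have [p [E' h]] := af _ (h16 l); exists (p, E').
pose p l := (pE l).1.
have /choice[F hF] : forall x : nat * (nat * tp), exists y : nat * ((nat -> R) * (nat -> R)),
    [/\ (x.2.1 <= y.1)%N, (x.1 <= y.1)%N & forall t, circ t -> ~ E y.1 t ->
    `|\sum_(Bs y.1 <= k < Bs y.1.+1) osc r y.2.1 y.2.2 t k - (ev (p x.1) t - ev x.2.2 t)| <= 16^-1 ^+ y.1 /\
    forall n, (n <= Bs y.1.+1)%N ->
      `|\sum_(Bs y.1 <= k < n) osc r y.2.1 y.2.2 t k| <=
      `|ev (p x.1) t - ev x.2.2 t| * (1 + ev (Y y.1) t ^+ 2) + 16^-1 ^+ y.1].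
  move=> [l [S P]] /=; pose q := p l ++ tscale (-1) P.
  have qE t : ev q t = ev (p l) t - ev P t by rewrite ev_cat ev_scale mulN1r.
  pose s := maxn (maxn S l) (maxn (deg q) (Num.truncn (nrm q)).+1).
  have [_ _ _ /(_ q)] := stagesP s; case.
  - by rewrite /s !leq_max leqnn !orbT.
  - by rewrite (@le_trans _ _ (Num.truncn (nrm q)).+1%:R) ?(ltW (truncnS_gt _))// ler_nat /s !leq_max leqnn !orbT.
  move=> a [b hab]; exists (s, (a, b)); split=> /=; rewrite ?/s ?leq_max ?leqnn ?orbT//.
  by move=> t tc Et; rewrite -qE; exact: hab.
(* The state is the first stage still free and the polynomial summed so far. *)
pose st := fix st l := if l is l'.+1 then
  let y := F (l', st l') in (y.1.+1, (st l').2 ++ oscl y.2.1 y.2.2 (Bs y.1) (Bs y.1.+1)) else (0%N, [::]).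
pose S l := (st l).1; pose P l := (st l).2.
pose s l := (F (l, st l)).1; pose al l := (F (l, st l)).2.1; pose bl l := (F (l, st l)).2.2.
have Ss l : (S l <= s l)%N by have [] := hF (l, st l).
have ls l : (l <= s l)%N by have [] := hF (l, st l).
have SE l : S l.+1 = (s l).+1 by [].
have S_lt l : (S l < S l.+1)%N by rewrite SE ltnS.
have S_le i j : (i <= j)%N -> (S i <= S j)%N by exact: ltn_homo_leq.
have BsS_lt l : (Bs (S l) < Bs (S l.+1))%N.
  by rewrite SE (leq_ltn_trans (Bs_le (Ss l)) (Bs_lt _)).
have BsS_le i j : (i <= j)%N -> (Bs (S i) <= Bs (S j))%N by move=> /S_le /Bs_le.
have sub l k : (Bs (s l) <= k < Bs (s l).+1)%N -> (Bs (S l) <= k < Bs (S l.+1))%N.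
  by move=> /andP[k1 k2]; rewrite (leq_trans (Bs_le (Ss l)) k1).
have /choice[ab hab] : forall k, exists z : R * R,
    (forall l, (Bs (s l) <= k < Bs (s l).+1)%N -> z = (al l k, bl l k)) /\
    ((forall l, ~~ (Bs (s l) <= k < Bs (s l).+1)%N) -> z = (0, 0)).
  move=> k; have [[l lk]|h] := pselect (exists l, Bs (s l) <= k < Bs (s l).+1)%N; last first.
    exists (0, 0); split=> // l lk; exfalso; apply: h; by exists l.
  exists (al l k, bl l k); split=> [l' l'k|/(_ l)]; last by rewrite lk.
  by rewrite (window_inj BsS_lt (sub _ _ lk) (sub _ _ l'k)).
pose a k := (ab k).1; pose b k := (ab k).2; pose T n t := \sum_(1 <= k < n) osc r a b t k.
have B1 l : (1 <= Bs (S l))%N by rewrite -Bs_start Bs_le.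
have Tgap l n t : (Bs (S l) <= n <= Bs (S l.+1))%N ->
    T n t = T (Bs (S l)) t + \sum_(Bs (s l) <= k < n) osc r (al l) (bl l) t k.
  move=> /andP[n1 n2]; rewrite /T (big_cat_nat (B1 l) n1) /=; congr (_ + _).
  have z m : (m <= Bs (s l))%N -> \sum_(Bs (S l) <= k < m) osc r a b t k = 0.
    move=> ml; rewrite big_nat big1// => k /andP[k1 k2].
    rewrite /osc /a /b; have [_ ->] := hab k; first by rewrite !mul0r addr0.
    move=> l'; apply/negP => l'k; have := sub _ _ l'k; have kl : (Bs (S l) <= k < Bs (S l.+1))%N.
      by rewrite k1 (leq_trans k2)// (leq_trans ml)// SE ltnW// Bs_lt.
    move=> /(window_inj BsS_lt kl) ll'; move: l'k; rewrite -ll' => /andP[+ _].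
    by rewrite leqNgt (leq_trans k2 ml).
  have [nl|ln] := leqP n (Bs (s l)); first by rewrite z// big_geq.
  rewrite (big_cat_nat (Bs_le (Ss l)) (ltnW ln)) /= z// add0r.
  apply: eq_big_nat => k /andP[k1 k2]; rewrite /osc /a /b.
  by have [h _] := hab k; rewrite (h l)// k1 (leq_trans k2).
have TP l t : T (Bs (S l)) t = ev (P l) t.
  elim: l => [|l ih]; first by rewrite /T [S 0]/= Bs_start big_geq// /ev big_nil.
  rewrite (Tgap l); last by rewrite leqnn andbT ltnW.
  by rewrite ih /P /= ev_cat ev_oscl.
have hF' l t : circ t -> ~ E (s l) t -> `|ev (P l.+1) t - ev (p l) t| <= 16^-1 ^+ l /\
    forall n, (n <= Bs (S l.+1))%N -> `|\sum_(Bs (s l) <= k < n) osc r (al l) (bl l) t k| <=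
      `|ev (p l) t - ev (P l) t| * (1 + ev (Y (s l)) t ^+ 2) + 16^-1 ^+ l.
  move=> tc Et; have [_ _ /(_ t tc Et)[h1 h2]] := hF (l, st l).
  have sl : 16^-1 ^+ s l <= 16^-1 ^+ l :> R by rewrite ler_wiXn2l ?ls//; lra.
  split=> [|n nl]; last by rewrite (le_trans (h2 n nl))// lerD2l.
  rewrite (le_trans _ sl)// (le_trans _ h1)// /P /= ev_cat ev_oscl.
  by rewrite le_eqVlt; apply/orP; left; apply/eqP; congr (`|_|); ring.
pose bad l := (pE l).2 `|` E (s l) `|` (circ `&` [set t | 2 ^+ l <= ev (Y (s l)) t]).
exists a, b, (lim_sup_set bad); split.
  have mE l : measurable (E l) by have [_ []] := stagesP l.
  have mp l : measurable (pE l).2 by have [] := hpE l.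
  have mY l : measurable (circ `&` [set t | 2 ^+ l <= ev (Y (s l)) t]).
    by apply: measurableI; [exact: measurable_circ|exact: measurable_ev_ge].
  have mb l : measurable (bad l) by do 2?[apply: measurableU].
  have C20 : 0 <= 2 + pi *+ 2 * C by rewrite addr_ge0// mulr_ge0 ?ltW// pmulrn_lgt0// pi_gt0.
  have := @borel_cantelli_geometric bad _ C20 mb => h.
  exists (lim_sup_set bad); split=> //; last first.
    apply: h => l; have mu1 : measurable ((pE l).2 `|` E (s l)) by apply: measurableU.
    have -> : (2 + pi *+ 2 * C) / 2 ^+ l = (2^-1 ^+ l + 2^-1 ^+ l) + pi *+ 2 * C / 2 ^+ l :> R.
      by rewrite exprVn; ring.
    have l16 : 16^-1 ^+ l <= 2^-1 ^+ l :> R by rewrite lerXn2r ?nnegrE//; lra.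
    apply: mu_setU => //.
      apply: mu_setU => //.
        by have [_ h1 _] := hpE l; rewrite (le_trans h1)// lee_fin.
      have [_ [_ h1] _ _] := stagesP (s l); rewrite (le_trans h1)// lee_fin (le_trans _ l16)//.
      by rewrite ler_wiXn2l ?ls//; lra.
    have [_ _ [Y0 ctY] _] := stagesP (s l).
    rewrite (le_trans (markov_ev Y0 _)) ?exprn_gt0// lee_fin ler_wpM2r ?invr_ge0 ?exprn_ge0//.
    by rewrite ler_wpM2l// ltW// pmulrn_lgt0// pi_gt0.
  by apply: bigcapT_measurable => n; apply: bigcup_measurable => k _; exact: mb.
move=> t tc tbad.
have [l0 hl0] : exists l0, forall l, (l0 <= l)%N -> ~ bad l t.
  apply: contrapT => h; apply: tbad => n _; apply: contrapT => hn; apply: h.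
  by exists n => l nl bl'; apply: hn; exists l.
(* With h = 16 ^ -(l + 1) and h' = 4 ^ -(l + 1), the previous sum is within 32 h of f and the
   running correction is at most 33 (h + h') + h; as h <= h', the total is at most 99 h'. *)
have est l n : (l0 <= l)%N -> (Bs (S l.+1) <= n <= Bs (S l.+2))%N ->
    `|f t - T n t| <= 99 * 4^-1 ^+ l.+1.
  move=> ll0 nl.
  have g l' : (l0 <= l')%N -> [/\ `|f t - ev (p l') t| <= 16^-1 ^+ l', ~ E (s l') t &
      0 <= ev (Y (s l')) t <= 2 ^+ l'].
    move=> /hl0 h; split.
    - by have [_ _] := hpE l'; apply=> // h'; apply: h; left; left.
    - by move=> h'; apply: h; left; right.
    have [_ _ [Y0 _] _] := stagesP (s l'); rewrite Y0 /= leNgt; apply/negP => h'.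
    by apply: h; right; split=> //=; exact: ltW.
  have [g1 g2 _] := g l ll0; have [g4 g5 /andP[g6 g7]] := g l.+1 (leqW ll0).
  have [k1 _] := hF' l t tc g2; have [_ k2] := hF' l.+1 t tc g5.
  have k3 := k2 n (andP nl).2.
  rewrite (Tgap _ _ _ nl) TP.
  have Y4 : ev (Y (s l.+1)) t ^+ 2 <= 4 ^+ l.+1.
    have -> : 4 ^+ l.+1 = (2 ^+ l.+1) ^+ 2 :> R by rewrite exprAC; congr (_ ^+ _); ring.
    by rewrite ler_sqr ?nnegrE ?exprn_ge0.
  have h4 : 16^-1 ^+ l.+1 * 4 ^+ l.+1 = 4^-1 ^+ l.+1 :> R.
    by rewrite -exprMn; congr (_ ^+ _); field.
  have h5 : 16^-1 ^+ l.+1 <= 4^-1 ^+ l.+1 :> R by rewrite lerXn2r ?nnegrE//; lra.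
  have h6 : 16^-1 ^+ l = 16 * 16^-1 ^+ l.+1 :> R by rewrite exprS; field.
  have h7 : 0 < 16^-1 ^+ l.+1 :> R := h16 _.
  have h8 : `|ev (p l.+1) t - ev (P l.+1) t| <= 33 * 16^-1 ^+ l.+1.
    move: g1 g4 k1; rewrite !h6 !ler_norml; move: (16^-1 ^+ _) h7 => h h7; lra.
  have h9 : `|ev (p l.+1) t - ev (P l.+1) t| * (1 + ev (Y (s l.+1)) t ^+ 2) <=
      33 * (16^-1 ^+ l.+1 * (1 + 4 ^+ l.+1)).
    rewrite mulrA ler_pM// ?lerD2l//; first by rewrite addr_ge0// sqr_ge0.
  rewrite [16^-1 ^+ l.+1 * (1 + _)]mulrDr mulr1 h4 in h9.
  move: g1 k1 k3 h9; rewrite h6.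
  move: (16^-1 ^+ l.+1) (4^-1 ^+ l.+1) (\sum_(_ <= _ < _) _) h5 h7 => h h' x h5 h7 g1 k1 k3 h9.
  have k4 := le_trans k3 (lerD h9 (lexx h)).
  by move: g1 k1 k4; rewrite !ler_norml; lra.
apply/cvgrPdist_le => e e0.
have [m hm] := @pow_small R 4^-1 (e / 99) ltac:(apply/andP; split; lra) ltac:(by rewrite divr_gt0).
exists (Bs (S (maxn l0 m).+1)) => // n /= nB.
have [l /andP[l1 l2]] := window BsS_lt (leq_trans (BsS_le 0 _ (leq0n _)) nB).
have ll : (maxn l0 m < l)%N.
  by rewrite -ltnS ltnNge; apply/negP => /BsS_le h; have := leq_trans l2 (leq_trans h nB); rewrite ltnn.
case: l l1 l2 ll => // l l1 l2; rewrite ltnS geq_max => /andP[ll0 ml].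
rewrite (le_trans (est l n ll0 _))//; first by rewrite l1 ltnW.
rewrite -ler_pdivlMl// [leRHS]mulrC (le_trans _ hm)// ler_wiXn2l ?(leqW ml)//; lra.
Qed.

End Representation.

(** * From one period to the whole line *)

Section Translation.
Context {R : realType}.
Local Notation mu := (@lebesgue_measure R).

(** The pushforward of Lebesgue measure under translation agrees with it on half-open intervals,
    hence everywhere by uniqueness. *)
Lemma negligible_translate (c : R) (N : set R) : mu.-negligible N ->
  mu.-negligible [set t | N (t + c)].
Proof.
move=> [A [mA A0 NA]]; pose T (t : measurableTypeR R) : measurableTypeR R := t + c.
have mT : measurable_fun setT T.
  by apply: continuous_measurable_fun => t; apply: cvgD; [exact: cvg_id|exact: cvg_cst].
have mTA : measurable (T @^-1` A) by rewrite -[X in measurable X]setTI; exact: mT.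
exists (T @^-1` A); split=> //; last by move=> t /= /NA.
rewrite -A0; symmetry.
apply: (@lebesgue_measure_unique R (measure_function_pushforward__canonical__measure_function_Measure mu mT)) => //.
move=> _ [[a b] _ <-] /=; rewrite /pushforward.
have -> : T @^-1` `]a, b]%classic = `](a - c), (b - c)]%classic.
  by apply/seteqP; split=> t /=; rewrite !in_itv /= ltrBlDr lerBrDr.
rewrite !lebesgue_measure_itv /= !lte_fin ltrD2r; case: ifP => // _.
by rewrite -!EFinB opprB addrA subrK.
Qed.

Lemma ae_of_circ (P : R -> Prop) (N : set R) : (forall t, P (t + pi *+ 2) <-> P t) ->
  mu.-negligible N -> (forall t, circ t -> ~ N t -> P t) -> {ae mu, forall t, P t}.
Proof.
move=> per nN hN; pose T : R := pi *+ 2.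
have T0 : 0 < T by rewrite pmulrn_lgt0// pi_gt0.
have perD n t : P (t + T *+ n) <-> P t.
  by elim: n => [|n ih]; rewrite ?mulr0n ?addr0// mulrSr addrA per.
have perB n t : P (t + - (T *+ n)) <-> P t by rewrite -[X in _ <-> P X](subrK (T *+ n)) perD.
pose F n := [set t | N (t + T *+ n)] `|` [set t | N (t + - (T *+ n))].
apply: (@negligibleS _ _ _ mu (\bigcup_n F n)); last first.
  by apply: negligible_bigcup => n; apply: negligibleU; exact: negligible_translate.
move=> t /= nP; pose m := Num.floor (t / T).
have := floor_itv (t / T); rewrite -/m ler_pdivlMr// ltr_pdivrMr// rmorphD mulrDl mul1r => /andP[m1 m2].
have cm : circ (t - m%:~R * T).
  by rewrite /circ /= in_itv /= subr_ge0 m1 /= lerBlDl ltW.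
have key : N (t - m%:~R * T) \/ P (t - m%:~R * T).
  have [|/(hN _ cm)] := pselect (N (t - m%:~R * T)); by [left|right].
exists `|m|%N => //; case: m cm key {m1 m2} => n cm.
  rewrite mulr_natl => -[h|/perB//]; by right.
rewrite NegzE mulrNz mulNr opprK -pmulrn mulr_natl => -[h|/perD//].
by left.
Qed.

End Translation.

(** * From real cosine-sine series to symmetric complex sums *)

Section Spectrum.
Context {R : realType}.
Context (r : nat -> int) (r_lt : forall k, (0 < k)%N -> (`|r k| < k)%N).

Let lambda (k : nat) : int := k%:Z ^+ 2 + r k.

Definition spectrum : set int :=
  [set k%:Z ^+ 2 + r k | k in [set k | (1 <= k)%N]] `|`
  [set - (k%:Z ^+ 2 + r k) | k in [set k | (1 <= k)%N]].

Lemma lambda_gt0 k : (0 < k)%N -> 0 < lambda k.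
Proof. by move=> k0; have := r_lt k0; rewrite /lambda; move: (r k) => x; nia. Qed.

Lemma lambda_lt k : (0 < k)%N -> lambda k < lambda k.+1.
Proof.
move=> k0; have := r_lt k0; have := r_lt (ltn0Sn k); rewrite /lambda.
by move: (r k) (r k.+1) => x y; nia.
Qed.

(** The value 0 at k = 0 makes every cut-off N fall between two consecutive values of [b]. *)
Let b (k : nat) : nat := if (0 < k)%N then `|lambda k|%N else 0.

Lemma absl_lt k : (b k < b k.+1)%N.
Proof.
rewrite /b /=; case: posnP => [->|k0]; first by have := lambda_gt0 (ltn0Sn 0); lia.
by have := lambda_gt0 k0; have := lambda_lt k0; lia.
Qed.

Lemma lambda_b k : (0 < k)%N -> lambda k = (b k)%:Z.
Proof. by move=> k0; rewrite /b k0; have := lambda_gt0 k0; lia. Qed.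

Lemma absl_inj : injective b.
Proof.
move=> i j ij; apply/eqP; rewrite eqn_leq; apply/andP; split; rewrite leqNgt; apply/negP => h.
  by have := leq_trans (absl_lt j) (ltn_homo_leq absl_lt h); rewrite ij ltnn.
by have := leq_trans (absl_lt i) (ltn_homo_leq absl_lt h); rewrite ij ltnn.
Qed.

Lemma partial_sumE (c : int -> R[i]) t N s : (b s <= N < b s.+1)%N ->
  partial_sum spectrum c t N = \sum_(1 <= k < s.+1)
    (c (lambda k) * expi ((lambda k)%:~R * t) + c (- lambda k) * expi ((- lambda k)%:~R * t)).
Proof.
move=> /andP[sN Ns]; pose q := index_iota 1 s.+1.
pose S := [seq lambda k | k <- q] ++ [seq - lambda k | k <- q].
have q0 k : k \in q -> (0 < k)%N by rewrite mem_index_iota => /andP[].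
have qN k : (0 < k)%N -> (k \in q) = (b k <= N)%N.
  move=> k0; rewrite mem_index_iota k0 /= ltnS; apply/idP/idP => [/(ltn_homo_leq absl_lt)/leq_trans|kN]; first by apply.
  rewrite leqNgt; apply/negP => /(ltn_homo_leq absl_lt) h.
  by have := leq_trans Ns (leq_trans h kN); rewrite ltnn.
have uS : uniq S.
  rewrite cat_uniq !map_inj_in_uniq ?iota_uniq /=.
  - rewrite andbT; apply/hasPn => _ /mapP[k /q0 k0 ->]; apply/negP => /mapP[j /q0 j0 e].
    by have := lambda_gt0 k0; have := lambda_gt0 j0; lia.
  - by move=> i j /q0 i0 /q0 j0; rewrite !lambda_b// => /oppr_inj[] /absl_inj.
  - by move=> i j /q0 i0 /q0 j0; rewrite !lambda_b// => -[] /absl_inj.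
rewrite /partial_sum (_ : _ `&` _ = [set` S]); last first.
  apply/seteqP; split=> n /=.
    move=> [[[k /= k0 <-]|[k /= k0 <-]]]; rewrite -/(lambda k) => hN; rewrite mem_cat; apply/orP; [left|right].
      by apply/mapP; exists k => //; rewrite qN//; move: hN; rewrite lambda_b//; lia.
    by apply/mapP; exists k => //; rewrite qN//; move: hN; rewrite lambda_b//; lia.
  rewrite mem_cat => /orP[] /mapP[k kq ->]; have k0 := q0 k kq; move: kq; rewrite qN// => kN.
    by split; [left; exists k|rewrite lambda_b//; lia].
  by split; [right; exists k|rewrite lambda_b//; lia].
by rewrite -fsbig_seq// big_cat /= !big_map -big_split.
Qed.

Lemma sum_complex (I : Type) (l : seq I) (x y : I -> R) :
  \sum_(i <- l) (x i +i* y i)%C = ((\sum_(i <- l) x i) +i* (\sum_(i <- l) y i))%C.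
Proof.
elim: l => [|i l ih]; first by rewrite !big_nil.
by rewrite !big_cons ih.
Qed.

Lemma cvg_complex (x y : nat -> R) (l m : R) : x @ \oo --> l -> y @ \oo --> m ->
  (fun n => (x n +i* y n)%C) @ \oo --> ((l +i* m)%C : R[i]^o).
Proof.
move=> hx hy; apply/(@cvgrPdist_le R[i] R[i]^o) => -[e e'].
rewrite ltcE /= => /andP[/eqP -> e0].
have e20 : 0 < e / 2 by rewrite divr_gt0.
move/cvgrPdist_le : hx => /(_ _ e20) hx; move/cvgrPdist_le : hy => /(_ _ e20) hy.
near=> n.
have h1 : `|l - x n| <= e / 2 by near: n.
have h2 : `|m - y n| <= e / 2 by near: n.
rewrite normc_def lecE /= eqxx /= (@le_trans _ _ (Num.sqrt (e ^+ 2)))//; last first.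
  by rewrite sqrtr_sqr ger0_norm// ltW.
rewrite ler_wsqrtr//; move: h1 h2; rewrite !ler_norml; move: (l - x n) (m - y n) => u v.
by move=> /andP[u1 u2] /andP[v1 v2]; nra.
Unshelve. all: by end_near. Qed.

Lemma expi_periodic (k : int) (t : R) : expi (k%:~R * (t + pi *+ 2)) = expi (k%:~R * t) :> R[i].
Proof.
have s x : sin (k%:~R * (pi *+ 2) + x) = sin x := @sin_int2pi R k x.
rewrite mulrDr addrC /expi s; congr (_ +i* _)%C.
by rewrite -[in LHS]sinDpihalf -addrA s sinDpihalf.
Qed.

Lemma Menshov_of_osc :
  (forall f, approx f -> exists (a b : nat -> R) (N : set R),
    (@lebesgue_measure R).-negligible N /\ forall t, circ t -> ~ N t ->
    (fun n => \sum_(1 <= k < n) osc r a b t k) @ \oo --> f t) ->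
  Menshov_spectrum R spectrum.
Proof.
move=> rep f [perf mRe mIm].
have [a1 [b1 [N1 [nN1 h1]]]] := rep _ (approx_measurable mRe).
have [a2 [b2 [N2 [nN2 h2]]]] := rep _ (approx_measurable mIm).
(* With a = a1 + i a2 and b = b1 + i b2, these are (a - i b) / 2 at lambda k and (a + i b) / 2 at -
   lambda k. *)
have /choice[c hc] : forall n : int, exists z : R[i], forall k, (0 < k)%N ->
    (n = lambda k -> z = ((a1 k + b2 k) / 2 +i* ((a2 k - b1 k) / 2))%C) /\
    (n = - lambda k -> z = ((a1 k - b2 k) / 2 +i* ((a2 k + b1 k) / 2))%C).
  move=> n; have [[k [k0 nk]]|h] := pselect (exists k, (0 < k)%N /\ n = lambda k).
    exists ((a1 k + b2 k) / 2 +i* ((a2 k - b1 k) / 2))%C => j j0; split.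
      by rewrite nk !lambda_b// => -[] /absl_inj ->.
    by have := lambda_gt0 k0; have := lambda_gt0 j0; rewrite nk; lia.
  have [[k [k0 nk]]|h'] := pselect (exists k, (0 < k)%N /\ n = - lambda k).
    exists ((a1 k - b2 k) / 2 +i* ((a2 k + b1 k) / 2))%C => j j0; split.
      by move=> nj; exfalso; apply: h; exists j.
    by rewrite nk !lambda_b// => /oppr_inj[] /absl_inj ->.
  by exists 0 => j j0; split=> nj; exfalso; [apply: h|apply: h']; exists j.
exists c; apply: (@ae_of_circ R _ (N1 `|` N2)).
- move=> t; rewrite perf.
  suff -> : partial_sum spectrum c (t + pi *+ 2) = partial_sum spectrum c t by [].
  apply/funext => N; rewrite /partial_sum; apply: eq_fsbigr => k _.
  by rewrite expi_periodic.
- exact: negligibleU.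
move=> t tc tN.
have {}h1 := h1 t tc (fun h => tN (or_introl h)).
have {}h2 := h2 t tc (fun h => tN (or_intror h)).
pose u n := ((\sum_(1 <= k < n) osc r a1 b1 t k) +i* (\sum_(1 <= k < n) osc r a2 b2 t k))%C.
have hu : u @ \oo --> (f t : R[i]^o).
  by have := cvg_complex h1 h2; case: (f t).
have uE N s : (b s <= N < b s.+1)%N -> partial_sum spectrum c t N = u s.+1.
  move=> /partial_sumE ->; rewrite /u -sum_complex; apply: eq_big_nat => k /andP[k0 _].
  have [/(_ erefl) -> _] := hc (lambda k) k k0; have [_ /(_ erefl) ->] := hc (- lambda k) k k0.
  rewrite rmorphN /= mulNr /expi cosN sinN /osc -/(lambda k).
  move: (cos _) (sin _) => x y; apply/eqP; rewrite eq_complex /=.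
  by apply/andP; split; apply/eqP; field.
move/(@cvgrPdist_le R[i] R[i]^o) : hu => hu; apply/(@cvgrPdist_le R[i] R[i]^o) => e e0.
have [m _ hm] := hu e e0; exists (b m) => // N /= mN.
have [s sN] := window absl_lt (leq0n N : (b 0 <= N)%N).
rewrite (uE N s sN); apply: hm => /=; move: sN => /andP[_ Ns].
rewrite leqNgt; apply/negP => /ltnW/(ltn_homo_leq absl_lt) h.
by have := leq_trans Ns (leq_trans h mN); rewrite ltnn.
Qed.

End Spectrum.

(** * Assembly of the spectrum *)

Theorem theorem2 (R : realType) (w : nat -> R) (hw : w @ \oo --> +oo) :
  exists r : nat -> int,
    (fun k => (r k)%:~R : R) =o_\oo w /\
    Menshov_spectrum R
      ([set k%:Z ^+ 2 + r k | k in [set k | (1 <= k)%N]] `|`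
       [set - (k%:Z ^+ 2 + r k) | k in [set k | (1 <= k)%N]]).
Proof.
have w_infty (A : R) : exists N, forall k, (N <= k)%N -> A <= w k.
  by move/cvgryPge : hw => /(_ A)[N _ hN]; exists N => k /hN.
have [C [Bs [r [Y [E [C0 B0 h]]]]]] := stages w_infty.
have B_lt s : (Bs s < Bs s.+1)%N by have [[]] := h s.
have hr k : (0 < k)%N -> exists s, [/\ (Bs s <= k < Bs s.+1)%N,
    s.+1%:R * `|(r k)%:~R| <= `|w k| & (`|r k| < k)%N].
  move=> k0; have [|s sk] := @window Bs k B_lt; first by rewrite B0.
  by exists s; have [[_ /(_ k sk)[]]] := h s.
exists r; split; last first.
  apply: Menshov_of_osc; first by move=> k /hr[s []].
  exact: represent C0 B0 h.
(* From stage s0 on, the factor s + 1 exceeds 1 / e, which gives |r k| <= e |w k|. *)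
apply/eqoP => e e0; pose s0 := Num.truncn e^-1.
exists (Bs s0) => // k /= sk.
have k0 : (0 < k)%N by rewrite (leq_trans _ sk)// -B0 (ltn_homo_leq B_lt).
have [s [/andP[s1 s2] s3 _]] := hr k k0.
have s0s : (s0 <= s)%N.
  rewrite leqNgt; apply/negP => /(ltn_homo_leq B_lt) hs.
  by have := leq_trans s2 (leq_trans hs sk); rewrite ltnn.
rewrite -ler_pdivrMl// (le_trans _ s3)// ler_wpM2r// (@le_trans _ _ s0.+1%:R)//.
  by rewrite ltW// truncnS_gt.
by rewrite ler_nat.
Qed.
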